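(* Let $n\ge2$, let $a_{00},\dots,a_{nn}\in\mathbb C$, and fix values of the square roots $\sqrt{2a_{00}}$, $\sqrt{2a_{n-1\,n-1}}$. On the set $\tilde{\mathcal U}$ defined in the context, consider the $SL(2,\mathbb C)$-invariant functions $$a_{ij}=\mathrm{tr}\,A^{(i)}A^{(j)},\qquad f_{ijk}=\mathrm{tr}\,[A^{(i)},A^{(j)}]A^{(k)}\qquad(0\le i,j,k\le n),$$ and the functions $\beta_i,q_i,q'_i$ ($1\le i\le n-2$), the matrix elements of $A^{(i)}$ in the accompanying basis, i.e. $\beta_i=\tfrac12\mathrm{tr}\,A^{(i)}\sigma_3$, $q_i=\mathrm{tr}\,A^{(i)}\sigma_-$, $q_i'=\mathrm{tr}\,A^{(i)}\sigma_+$. These two families of functions are birationally connected: all $a_{ij},f_{ijk}$ are rational functions of the $\beta_i,q_i,q'_i$, and conversely all $\beta_i,q_i,q_i'$ are rational functions of the $a_{ij},f_{ijk}$. (Here a rational expression is required to have its denominator nonvanishing on, and to hold on, a Zariski-dense open subset of $\tilde{\mathcal U}$; its coefficients may depend on the parameters $a_{kk}$ and the chosen square roots.)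
   Context: For $A,B\in sl(2,\mathbb C)$ put $\langle A,B\rangle=\mathrm{tr}(AB)$. Quadrics. For $a\in\mathbb C$, $a\neq0$, $Q'_a=\{A\in sl(2,\mathbb C):\langle A,A\rangle=a\}$. For $a=0$, $Q'_0$ is the cone of nilpotent matrices with blown-up vertex: the set of pairs $A'=(A,\tilde A)$ with $\tilde A$ a line in $sl(2,\mathbb C)$ spanned by a nonzero nilpotent matrix and $A\in\tilde A$. In both cases an element is written $A'$ and its matrix (''affine component'') is $A$. The group $SL(2,\mathbb C)$ acts by conjugation on both components, and componentwise on products. The space $\tilde M$ is the set of tuples $(A'^{(0)},\dots,A'^{(n)})\in\prod_{k=0}^nQ'_{a_{kk}}$ such that $\sum_kA^{(k)}=0$ and the matrices $A^{(0)},\dots,A^{(n)}$ cannot be simultaneously conjugated to upper-triangular form. Lines $(\sigma)$. For $A'\in Q'_a$ and a chosen value $s=\sqrt{2a}$ of the square root, $(\sigma^{(\pm s)})$ is: if $a\ne0$, the one-dimensional eigenspace of $\mathrm{ad}_A=[A,\cdot]$ on $sl(2,\mathbb C)$ with eigenvalue $\pm s$; if $a=0$, the line $\tilde A$. Let $\sigma^{(-\sqrt{2a_{00}})}$ be a nonzero vector of the line $(\sigma^{(-\sqrt{2a_{00}})})$ attached to $A'^{(0)}$ and $\sigma^{(\sqrt{2a_{n-1\,n-1}})}$ a nonzero vector of the line attached to $A'^{(n-1)}$. $\tilde{\mathcal U}$ is the set of elements of $\tilde M$ with $\langle\sigma^{(-\sqrt{2a_{00}})},\sigma^{(\sqrt{2a_{n-1\,n-1}})}\rangle\ne0$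 and $\langle\sigma^{(-\sqrt{2a_{00}})},A^{(n)}\rangle\neq0$. A standard basis of $sl(2,\mathbb C)$ is a basis $\sigma_-,\sigma_+,\sigma_3$ with $\langle\sigma_\pm,\sigma_\pm\rangle=\langle\sigma_\pm,\sigma_3\rangle=0$, $\langle\sigma_+,\sigma_-\rangle=1$, $[\sigma_+,\sigma_-]=\sigma_3$. For an element of $\tilde{\mathcal U}$ there is a unique standard basis, the accompanying basis, with $\sigma_-\in(\sigma^{(-\sqrt{2a_{00}})})$, $\sigma_+\in(\sigma^{(\sqrt{2a_{n-1\,n-1}})})$, $\langle\sigma_-,A^{(n)}\rangle=1$. *)

(* Defs.v *)
From mathcomp Require Import all_boot all_order all_algebra.
From mathcomp Require Import classical_sets reals complex mpoly.
Set Implicit Arguments.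
Unset Strict Implicit.
Unset Printing Implicit Defensive.
Import GRing.Theory.
Local Open Scope ring_scope.
Local Open Scope classical_set_scope.

(* Everything is set up over a field C, later specialised to the complex
   numbers R[i] of a real type R. *)

Section Sl2.
Variable C : fieldType.
Implicit Types (A B : 'M[C]_2).

Definition sl2 : {vspace 'M[C]_2} := lker (linfun (@mxtrace C 2 : _ -> C^o)).

Definition bracket A B : 'M[C]_2 := A *m B - B *m A.

Definition tform A B : C := \tr (A *m B).

Definition nilpotent_mx A : Prop := exists k : nat, A ^+ k = 0.

Definition standard_basis (sm sp s3 : 'M[C]_2) : Prop :=
  [/\ basis_of sl2 [:: sm; sp; s3],
      tform sm sm = 0 /\ tform sp sp = 0,
      tform sm s3 = 0 /\ tform sp s3 = 0,
      tform sp sm = 1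
    & bracket sp sm = s3].

End Sl2.

Section Configurations.
Variable C : fieldType.

(* A point A' of Q'_a.  The field [line] is the line of the blow-up when a = 0;
   when a != 0 there is no second component and [line] is set to 0. *)
Record qpoint := QPoint { mat : 'M[C]_2; line : {vspace 'M[C]_2} }.

Definition in_quadric (a : C) (p : qpoint) : Prop :=
  if a == 0 then
    (exists N : 'M[C]_2,
        [/\ N \in sl2 C, N != 0, nilpotent_mx N & line p = <[N]>%VS])
    /\ mat p \in line p
  else [/\ mat p \in sl2 C, tform (mat p) (mat p) = a & line p = 0%VS].

Definition conf (n : nat) : Type := 'I_n.+1 -> qpoint.

Definition triangularizable n (x : conf n) : Prop :=
  exists2 g : 'M[C]_2, \det g = 1
    & forall k, is_trig_mx (g *m mat (x k) *m invmx g)^T.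

Definition Mtilde n (a : 'I_n.+1 -> C) : set (conf n) :=
  [set x | [/\ forall k, in_quadric (a k) (x k),
               \sum_k mat (x k) = 0
             & ~ triangularizable x]].

(* The line (sigma^(t)) attached to a point of Q'_a, where t is one of the two
   square roots of 2a. *)
Definition sigma_line (a : C) (p : qpoint) (t : C) : set 'M[C]_2 :=
  [set v | if a == 0 then (v \in line p : Prop)
           else v \in sl2 C /\ bracket (mat p) v = t *: v].

(* s0 and s1 stand for the chosen square roots of 2 a_00 and of
   2 a_(n-1)(n-1). *)
Definition Utilde n (a : 'I_n.+1 -> C) (s0 s1 : C) : set (conf n) :=
  [set x | Mtilde a x /\
    exists sm sp : 'M[C]_2,
      [/\ sm != 0 /\ sigma_line (a ord0) (x ord0) (- s0) sm,
          sp != 0 /\ sigma_line (a (inord n.-1)) (x (inord n.-1)) s1 sp,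
          tform sm sp != 0
        & tform sm (mat (x ord_max)) != 0]].

Definition accompanying n (a : 'I_n.+1 -> C) (s0 s1 : C) (x : conf n)
    (b : 'M[C]_2 * 'M[C]_2 * 'M[C]_2) : Prop :=
  let: (sm, sp, s3) := b in
  [/\ standard_basis sm sp s3,
      sigma_line (a ord0) (x ord0) (- s0) sm,
      sigma_line (a (inord n.-1)) (x (inord n.-1)) s1 sp
    & tform sm (mat (x ord_max)) = 1].

(* The accompanying basis (sigma_-, sigma_+, sigma_3); it exists and is unique
   on Utilde, and the default value (0, 0, 0) only matters elsewhere. *)
Definition acc_basis n (a : 'I_n.+1 -> C) (s0 s1 : C) (x : conf n) :=
  xget (0, 0, 0) [set b | accompanying a s0 s1 x b].

Definition sigma_minus n a s0 s1 (x : conf n) := (acc_basis a s0 s1 x).1.1.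
Definition sigma_plus n a s0 s1 (x : conf n) := (acc_basis a s0 s1 x).1.2.
Definition sigma_3 n a s0 s1 (x : conf n) := (acc_basis a s0 s1 x).2.

Definition a_fun n (i j : 'I_n.+1) (x : conf n) : C :=
  \tr (mat (x i) *m mat (x j)).

Definition f_fun n (i j k : 'I_n.+1) (x : conf n) : C :=
  \tr (bracket (mat (x i)) (mat (x j)) *m mat (x k)).

Definition beta_fun n a s0 s1 (i : 'I_n.+1) (x : conf n) : C :=
  2^-1 * \tr (mat (x i) *m sigma_3 a s0 s1 x).

Definition q_fun n a s0 s1 (i : 'I_n.+1) (x : conf n) : C :=
  \tr (mat (x i) *m sigma_minus a s0 s1 x).

Definition q'_fun n a s0 s1 (i : 'I_n.+1) (x : conf n) : C :=
  \tr (mat (x i) *m sigma_plus a s0 s1 x).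

Definition inner (n : nat) : predArgType :=
  {i : 'I_n.+1 | (1 <= i <= n - 2)%N}.

Definition invariants n
    (u : ('I_n.+1 * 'I_n.+1) + ('I_n.+1 * 'I_n.+1 * 'I_n.+1)) : conf n -> C :=
  match u with
  | inl (i, j) => a_fun i j
  | inr (i, j, k) => f_fun i j k
  end.

Definition matrix_elements n (a : 'I_n.+1 -> C) (s0 s1 : C)
    (u : inner n + inner n + inner n) : conf n -> C :=
  match u with
  | inl (inl i) => beta_fun a s0 s1 (val i)
  | inl (inr i) => q_fun a s0 s1 (val i)
  | inr i => q'_fun a s0 s1 (val i)
  end.

(* Zariski topology of the product of the spaces sl2 (affine) and P(sl2): the
   closed sets are cut out by polynomials in the entries of the matrices A_k
   and of vectors w_k spanning the lines, homogeneous in each w_k separately.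
   When the second component is absent, w_k = 0.  The index (b, k, i, j) stands
   for the entry (i, j) of A_k if b is false and of w_k if b is true. *)
Definition coord_idx (n : nat) : predArgType :=
  (bool * 'I_n.+1 * 'I_2 * 'I_2)%type.

Definition coords n (A w : 'I_n.+1 -> 'M[C]_2) : 'I_#|coord_idx n| -> C :=
  fun l => let: (b, k, i, j) := enum_val l in
           if b then w k i j else A k i j.

Definition multihomogeneous n (p : {mpoly C[#|coord_idx n|]}) : Prop :=
  exists d : 'I_n.+1 -> nat,
    forall (c : 'I_n.+1 -> C) (A w : 'I_n.+1 -> 'M[C]_2),
      p.@[coords A (fun k => c k *: w k)]
      = (\prod_k c k ^+ d k) * p.@[coords A w].

Definition zero_locus n (F : set {mpoly C[#|coord_idx n|]}) : set (conf n) :=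
  [set x | forall w : 'I_n.+1 -> 'M[C]_2,
      (forall k, line (x k) = <[w k]>%VS) ->
      forall p, F p -> p.@[coords (fun k => mat (x k)) w] = 0].

(* Topology induced on a set S of configurations. *)
Definition zariski_closed_in n (S Z : set (conf n)) : Prop :=
  exists2 F : set {mpoly C[#|coord_idx n|]},
    forall p, F p -> multihomogeneous p & Z = S `&` zero_locus F.

Definition zariski_open_in n (S V : set (conf n)) : Prop :=
  V `<=` S /\ zariski_closed_in S (S `\` V).

Definition zariski_dense_in n (S V : set (conf n)) : Prop :=
  forall Z, zariski_closed_in S Z -> V `<=` Z -> S `<=` Z.

Definition rational_in n (S : set (conf n)) (I : finType)
    (h : I -> conf n -> C) (g : conf n -> C) : Prop :=
  exists (P Q : {mpoly C[#|I|]}) (V : set (conf n)),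
    [/\ zariski_open_in S V, zariski_dense_in S V
      & forall x, V x ->
          let v := fun l => h (enum_val l) x in
          Q.@[v] != 0 /\ g x = P.@[v] / Q.@[v]].

End Configurations.

(* Main.v *)
(* In the accompanying basis A^(0) is lower and A^(n-1) upper triangular with
   diagonal entries +- s0/2 and +- s1/2, and the upper right entry of A^(n) is 1.
   Hence tr A^(n)^2 = a_nn and the vanishing of the sum of the A^(k) make all the
   matrix entries polynomials in the beta_i, q_i, q'_i.

   Conversely, (ad_{A^(0)} - s0) ad_{A^(0)} A^(n) = 2 (a_00 a_nn - a_0n^2) sigma_-.
   Pairing this vector with A^(i) and with [A^(i), A^(n)] yields q_i and
   beta_i - beta_n q_i; since beta_(n-1) = s1/2 this determines beta_n, and then
   everything, wherever D := (a_00 a_nn - a_0n^2)^2 q_(n-1) is nonzero.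

   To see that D <> 0 defines a dense subset, fix the accompanying basis and move
   an inner A^(i) in its quadric by unipotent conjugations (or along the ruling when
   A^(i) = 0), correcting A^(0), A^(n-1), A^(n).  Along such a polynomial curve a
   polynomial that is nonzero somewhere has finitely many zeros.  The condition that
   the matrices are not simultaneously triangularizable need not be followed along
   the curve, because a_00 a_nn <> a_0n^2 implies it. *)

Require Import Defs.
From mathcomp Require Import all_boot all_order all_algebra.
From mathcomp Require Import classical_sets reals complex mpoly.
From mathcomp Require Import ring zify.
Set Implicit Arguments.
Unset Strict Implicit.
Unset Printing Implicit Defensive.
Import GRing.Theory Num.Theory.
Local Open Scope ring_scope.
Local Open Scope classical_set_scope.

(** * Algebras of functions, and matrices with entries in them *)

Section RingClosed.
Variables (F : comNzRingType) (T : Type).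
Implicit Types f g : T -> F.

(** One interface for three algebras: polynomial functions of a curve parameter, rational
    expressions on a fixed set, and polynomials in the coordinates of a configuration. *)
Definition ring_closed (K : (T -> F) -> Prop) : Prop :=
  [/\ forall f g, f =1 g -> K f -> K g,
      forall c, K (fun=> c),
      forall f g, K f -> K g -> K (fun x => f x + g x)
    & forall f g, K f -> K g -> K (fun x => f x * g x)].

Variable K : (T -> F) -> Prop.
Hypothesis clK : ring_closed K.

Lemma ring_closed_eq f g : f =1 g -> K f -> K g.
Proof. by case: clK => H _ _ _; apply: H. Qed.

Lemma ring_closed_cst c : K (fun=> c).
Proof. by case: clK. Qed.

Lemma ring_closedD f g : K f -> K g -> K (fun x => f x + g x).
Proof. by case: clK => _ _ H _; apply: H. Qed.

Lemma ring_closedM f g : K f -> K g -> K (fun x => f x * g x).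
Proof. by case: clK => _ _ _ H; apply: H. Qed.

Lemma ring_closedN f : K f -> K (fun x => - f x).
Proof.
move=> Kf; apply: ring_closed_eq (ring_closedM (ring_closed_cst (- 1)) Kf).
by move=> x; rewrite mulN1r.
Qed.

Lemma ring_closedB f g : K f -> K g -> K (fun x => f x - g x).
Proof. by move=> Kf /ring_closedN; apply: ring_closedD. Qed.

Lemma ring_closed_sum (J : Type) (s : seq J) (P : pred J) (f : J -> T -> F) :
  (forall j, P j -> K (f j)) -> K (fun x => \sum_(j <- s | P j) f j x).
Proof.
move=> Kf; elim: s => [|j s IHs].
  by apply: ring_closed_eq (ring_closed_cst 0) => x; rewrite big_nil.
have [Pj|nPj] := boolP (P j).
  by apply: ring_closed_eq (ring_closedD (Kf j Pj) IHs) => x; rewrite big_cons Pj.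
by apply: ring_closed_eq IHs => x; rewrite big_cons (negPf nPj).
Qed.

Lemma ring_closed_prod (J : Type) (s : seq J) (f : J -> T -> F) :
  (forall j, K (f j)) -> K (fun x => \prod_(j <- s) f j x).
Proof.
move=> Kf; elim: s => [|j s IHs].
  by apply: ring_closed_eq (ring_closed_cst 1) => x; rewrite big_nil.
by apply: ring_closed_eq (ring_closedM (Kf j) IHs) => x; rewrite big_cons.
Qed.

Lemma ring_closedX f k : K f -> K (fun x => f x ^+ k).
Proof.
move=> Kf; elim: k => [|k IHk]; first exact: ring_closed_cst.
by apply: ring_closed_eq (ring_closedM Kf IHk) => x; rewrite exprS.
Qed.

Lemma ring_closed_meval m (p : {mpoly F[m]}) (v : 'I_m -> T -> F) :
  (forall l, K (v l)) -> K (fun x => p.@[fun l => v l x]).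
Proof.
move=> Kv; apply: (@ring_closed_eq
  (fun x => \sum_(c <- msupp p) p@_c * \prod_(l <- index_enum 'I_m) v l x ^+ c l)).
  by move=> x; rewrite mevalE.
apply: ring_closed_sum => c _; apply: ring_closedM; first exact: ring_closed_cst.
by apply: ring_closed_prod => l; apply: ring_closedX.
Qed.

Definition closed_mx m k (A : T -> 'M[F]_(m, k)) : Prop :=
  forall i j, K (fun x => A x i j).

Lemma closed_mx_cst m k (A : 'M[F]_(m, k)) : closed_mx (fun=> A).
Proof. by move=> i j; apply: ring_closed_cst. Qed.

Lemma closed_mxD m k (A B : T -> 'M[F]_(m, k)) :
  closed_mx A -> closed_mx B -> closed_mx (fun x => A x + B x).
Proof.
move=> KA KB i j; apply: ring_closed_eq (ring_closedD (KA i j) (KB i j)).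
by move=> x; rewrite mxE.
Qed.

Lemma closed_mxN m k (A : T -> 'M[F]_(m, k)) :
  closed_mx A -> closed_mx (fun x => - A x).
Proof.
move=> KA i j; apply: ring_closed_eq (ring_closedN (KA i j)).
by move=> x; rewrite mxE.
Qed.

Lemma closed_mxZ m k c (A : T -> 'M[F]_(m, k)) :
  K c -> closed_mx A -> closed_mx (fun x => c x *: A x).
Proof.
move=> Kc KA i j; apply: ring_closed_eq (ring_closedM Kc (KA i j)).
by move=> x; rewrite mxE.
Qed.

Lemma closed_mxM m k l (A : T -> 'M[F]_(m, k)) (B : T -> 'M[F]_(k, l)) :
  closed_mx A -> closed_mx B -> closed_mx (fun x => A x *m B x).
Proof.
move=> KA KB i j.
apply: (@ring_closed_eq (fun x => \sum_(r <- index_enum 'I_k) A x i r * B x r j)).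
  by move=> x; rewrite mxE.
by apply: ring_closed_sum => r _; apply: ring_closedM.
Qed.

Lemma closed_mx_tr m (A : T -> 'M[F]_m) : closed_mx A -> K (fun x => \tr (A x)).
Proof. by move=> KA; apply: ring_closed_sum => i _; apply: KA. Qed.

End RingClosed.

(** * Nonvanishing of polynomial functions of one parameter *)

Section PolynomialCurves.
Variable C : numFieldType.
Implicit Types (f g : C -> C) (P : {poly C}).

Definition polynomial_fun f : Prop := exists P, forall t, f t = P.[t].

Lemma polynomial_fun_closed : ring_closed polynomial_fun.
Proof.
split=> [f g fg [P fP] | c | f g [P fP] [Q gQ] | f g [P fP] [Q gQ]].
- by exists P => t; rewrite -fg.
- by exists c%:P => t; rewrite hornerC.
- by exists (P + Q) => t; rewrite hornerD fP gQ.
- by exists (P * Q) => t; rewrite hornerM fP gQ.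
Qed.

Lemma polynomial_fun_id : polynomial_fun id.
Proof. by exists 'X => t; rewrite hornerX. Qed.

(** In characteristic zero the integers below [size P] are distinct and outnumber the possible
    roots. *)
Lemma poly_nonroot P : P != 0 -> exists t, P.[t] != 0.
Proof.
move=> P0; pose s := [seq k%:R : C | k <- iota 0 (size P)].
have us : uniq s.
  rewrite map_inj_uniq ?iota_uniq // => i j /eqP; rewrite eqr_nat; exact/eqP.
have [/allP Ps|/allPn[t _ Pt]] := boolP (all (root P) s); last by exists t.
have := max_poly_roots P0 _ us; rewrite size_map size_iota ltnn => H.
by move: (H (introT allP Ps)).
Qed.

(** The product of two nonzero polynomials is nonzero. Every density argument below rests on this:
    an open condition met at one parameter can be combined with another one met elsewhere. *)
Lemma polynomial_fun_nonvanish f g : polynomial_fun f -> polynomial_fun g ->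
  (exists t, f t != 0) -> (exists t, g t != 0) -> exists t, f t != 0 /\ g t != 0.
Proof.
move=> [P fP] [Q gQ] [t ft] [u gu].
have [|z] := @poly_nonroot (P * Q).
  rewrite mulf_neq0 //; apply/eqP => P0; first by rewrite fP P0 horner0 eqxx in ft.
  by rewrite gQ P0 horner0 eqxx in gu.
by rewrite hornerM mulf_eq0 negb_or => /andP[Pz Qz]; exists z; rewrite fP gQ.
Qed.

Lemma quadratic_nonvanish (c0 c1 c2 : C) : [|| c0 != 0, c1 != 0 | c2 != 0] ->
  exists t, c0 + c1 * t + c2 * t ^+ 2 != 0.
Proof.
move=> c_neq0; have [|t] := @poly_nonroot (Poly [:: c0; c1; c2]).
  apply: contraTneq c_neq0 => P0; have c i : [:: c0; c1; c2]`_i = 0.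
    by rewrite -coef_Poly P0 coef0.
  by move: (c 0%N) (c 1%N) (c 2%N) => /= -> -> ->; rewrite eqxx.
rewrite horner_Poly /= mul0r add0r => Pt; exists t; apply: contraNneq Pt => <-.
by apply/eqP; ring.
Qed.

(** The square has degree 4 and cannot cancel against a constant. The Gram determinant takes this
    shape along the curves used later. *)
Lemma quadratic_sqr_nonvanish (c c0 c1 c2 : C) : c2 != 0 ->
  exists t, c - (c0 + c1 * t + c2 * t ^+ 2) ^+ 2 != 0.
Proof.
move=> c2_neq0; pose P := Poly [:: c0; c1; c2].
have sP : size P = 3%N by rewrite (@PolyK _ 0).
have [|t] := @poly_nonroot (c%:P - P ^+ 2).
  rewrite subr_eq0; apply/eqP => /(congr1 (fun Q : {poly C} => (size Q).-1)) /=.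
  by rewrite size_exp sP size_polyC; case: eqP.
rewrite hornerD hornerN horner_exp hornerC horner_Poly /= mul0r add0r => Pt.
exists t; apply: contraNneq Pt => <-.
by apply/eqP; ring.
Qed.

End PolynomialCurves.

(** * Traceless 2x2 matrices *)

Section Sl2Calculus.
Variable C : numFieldType.
Implicit Types (A B X Y Z : 'M[C]_2).

Definition sl2_mx (b q r : C) : 'M[C]_2 :=
  \matrix_(i, j) if i == 0 then if j == 0 then b else q
                 else if j == 0 then r else - b.

Lemma mem_sl2 A : (A \in sl2 C) = (\tr A == 0).
Proof. by rewrite memv_ker lfunE. Qed.

Lemma sl2_mxP A : reflect (exists b q r, A = sl2_mx b q r) (A \in sl2 C).
Proof.
rewrite mem_sl2; apply: (iffP eqP) => [trA | [b [q [r ->]]]]; last first.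
  by rewrite /mxtrace !big_ord_recl big_ord0 !mxE /= addr0 subrr.
exists (A 0 0), (A 0 1), (A 1 0); apply/matrixP => i j; rewrite mxE.
have := trA; rewrite /mxtrace !big_ord_recl big_ord0 addr0.
move=> /eqP; rewrite addr_eq0 => /eqP A00.
have i1 : lift ord0 ord0 = 1 :> 'I_2 by apply: val_inj.
rewrite i1 in A00.
have ord2 (k : 'I_2) : k = if k == 0 then 0 else 1.
  by case: k => [[|[|//]] hk]; apply: val_inj.
rewrite [in LHS](ord2 i) [in LHS](ord2 j).
by case: (i == 0); case: (j == 0); rewrite ?A00 ?opprK.
Qed.

Lemma sl2_mxD b q r b' q' r' :
  sl2_mx b q r + sl2_mx b' q' r' = sl2_mx (b + b') (q + q') (r + r').
Proof.
by apply/matrixP => i j; rewrite !mxE; case: eqP; case: eqP => // *; rewrite opprD.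
Qed.

Lemma sl2_mxZ c b q r : c *: sl2_mx b q r = sl2_mx (c * b) (c * q) (c * r).
Proof.
by apply/matrixP => i j; rewrite !mxE; case: eqP; case: eqP => // *; rewrite mulrN.
Qed.

Lemma sl2_mxN b q r : - sl2_mx b q r = sl2_mx (- b) (- q) (- r).
Proof. by rewrite -scaleN1r sl2_mxZ !mulN1r. Qed.

Lemma tform_sl2_mx b q r b' q' r' :
  tform (sl2_mx b q r) (sl2_mx b' q' r') = 2 * b * b' + q * r' + r * q'.
Proof.
rewrite /tform /mxtrace !big_ord_recl big_ord0 !mxE !big_ord_recl !big_ord0.
by rewrite !mxE /=; ring.
Qed.

Lemma bracket_sl2_mx b q r b' q' r' :
  bracket (sl2_mx b q r) (sl2_mx b' q' r') =
  sl2_mx (q * r' - r * q') (2 * (b * q' - q * b')) (2 * (r * b' - b * r')).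
Proof.
apply/matrixP => i j; rewrite /bracket !mxE !big_ord_recl !big_ord0 !mxE /=.
by case: eqP => ?; case: eqP => ? /=; ring.
Qed.

Definition sl2_mxE := (sl2_mxN, sl2_mxZ, sl2_mxD, bracket_sl2_mx, tform_sl2_mx).

Lemma bracket_sl2 X Y : bracket X Y \in sl2 C.
Proof.
by rewrite mem_sl2 /bracket raddfB /= mxtrace_mulC subrr.
Qed.

Lemma tformC X Y : tform X Y = tform Y X.
Proof. exact: mxtrace_mulC. Qed.

Lemma tformDl X Y Z : tform (X + Y) Z = tform X Z + tform Y Z.
Proof. by rewrite /tform mulmxDl mxtraceD. Qed.

Lemma tformZl c X Y : tform (c *: X) Y = c * tform X Y.
Proof. by rewrite /tform -scalemxAl mxtraceZ. Qed.

Lemma tformDr X Y Z : tform Z (X + Y) = tform Z X + tform Z Y.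
Proof. by rewrite !(tformC Z) tformDl. Qed.

Lemma tformZr c X Y : tform X (c *: Y) = c * tform X Y.
Proof. by rewrite !(tformC X) tformZl. Qed.

Lemma tform_bracketl X Y : tform (bracket X Y) X = 0.
Proof.
by rewrite /tform /bracket mulmxBl raddfB /= [X in _ - X]mxtrace_mulC -mulmxA subrr.
Qed.

Lemma bracketN X Y : bracket Y X = - bracket X Y.
Proof. by rewrite /bracket opprB. Qed.

Lemma tform_bracketr X Y : tform (bracket X Y) Y = 0.
Proof. by rewrite bracketN -scaleN1r tformZl tform_bracketl mulr0. Qed.

Lemma bracketZl c X Y : bracket (c *: X) Y = c *: bracket X Y.
Proof. by rewrite /bracket -scalemxAl -scalemxAr -scalerBr. Qed.

Lemma bracketZr c X Y : bracket X (c *: Y) = c *: bracket X Y.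
Proof. by rewrite bracketN bracketZl bracketN scalerN opprK. Qed.

Lemma bracketDl X Y Z : bracket (X + Y) Z = bracket X Z + bracket Y Z.
Proof. by rewrite /bracket mulmxDl mulmxDr opprD addrACA. Qed.

Lemma tform_cycle X Y Z : tform (bracket X Y) Z = tform (bracket Y Z) X.
Proof.
rewrite /tform /bracket !mulmxBl !raddfB /=; congr (_ - _).
  by rewrite -mulmxA mxtrace_mulC.
by rewrite -mulmxA mxtrace_mulC -!mulmxA mxtrace_mulC -mulmxA.
Qed.

(** Up to constants the bracket is the cross product of a three-dimensional quadratic space; this is
    the expansion of X in the dual basis of P, Q, S, multiplied by their volume. *)
Lemma sl2_triple_identity P Q S X :
  P \in sl2 C -> Q \in sl2 C -> S \in sl2 C -> X \in sl2 C ->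
  tform (bracket P Q) S *: X =
  tform X P *: bracket Q S + tform X Q *: bracket S P + tform X S *: bracket P Q.
Proof.
move=> /sl2_mxP[p1 [p2 [p3 ->]]] /sl2_mxP[q1 [q2 [q3 ->]]].
move=> /sl2_mxP[s1 [s2 [s3 ->]]] /sl2_mxP[x1 [x2 [x3 ->]]].
by rewrite !sl2_mxE; congr sl2_mx; ring.
Qed.

(** The analogue of the vector triple product formula. *)
Lemma double_bracket X Y : X \in sl2 C -> Y \in sl2 C ->
  bracket X (bracket X Y) = 2 *: (tform X X *: Y - tform X Y *: X).
Proof.
move=> /sl2_mxP[p1 [p2 [p3 ->]]] /sl2_mxP[q1 [q2 [q3 ->]]].
by rewrite !sl2_mxE; congr sl2_mx; ring.
Qed.

(** The analogue of the Binet-Cauchy identity for cross products. *)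
Lemma tform_bracket_bracket P Q X Y :
  P \in sl2 C -> Q \in sl2 C -> X \in sl2 C -> Y \in sl2 C ->
  tform (bracket P Q) (bracket X Y)
  = 2 * (tform P Y * tform Q X - tform P X * tform Q Y).
Proof.
move=> /sl2_mxP[p1 [p2 [p3 ->]]] /sl2_mxP[q1 [q2 [q3 ->]]].
move=> /sl2_mxP[s1 [s2 [s3 ->]]] /sl2_mxP[x1 [x2 [x3 ->]]].
by rewrite !sl2_mxE; ring.
Qed.

Lemma sl2_det A : A \in sl2 C -> \det A = - (2^-1 * tform A A).
Proof.
move=> /sl2_mxP[b [q [r ->]]]; rewrite !sl2_mxE.
by rewrite (expand_det_row _ 0) !big_ord_recl big_ord0 /cofactor !det_mx11 !mxE /=; field.
Qed.

Lemma sl2_sqr A : A \in sl2 C -> A ^+ 2 = (2^-1 * tform A A)%:M.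
Proof.
move=> /sl2_mxP[b [q [r ->]]]; rewrite !sl2_mxE; apply/matrixP => i j.
rewrite expr2 !mxE !big_ord_recl big_ord0 !mxE /=.
by case: i j => [[|[|//]] hi] [[|[|//]] hj] /=; rewrite ?mulr1n ?mulr0n; field.
Qed.

(** A nilpotent matrix has determinant zero, and the determinant is minus half the form; conversely
    the square of A is the scalar given by half the form. *)
Lemma nilpotent_sl2P A : A \in sl2 C -> nilpotent_mx A <-> tform A A = 0.
Proof.
move=> sA; split=> [[k Ak0] | A0]; last first.
  by exists 2%N; rewrite sl2_sqr // A0 mulr0 raddf0.
have: \det (A ^+ k) = 0 by rewrite Ak0 det0.
have -> : \det (A ^+ k) = (\det A) ^+ k.
  by elim: k {Ak0} => [|k IHk]; rewrite ?expr0 ?det1 // !exprS det_mulmx IHk.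
move=> /eqP; rewrite expf_eq0 sl2_det // oppr_eq0 mulf_eq0 invr_eq0 pnatr_eq0.
by move=> /andP[_ /orP[//|/eqP]].
Qed.

End Sl2Calculus.

(** * Standard bases generated by a pair of isotropic vectors *)

Section StandardBasis.
Variable C : numFieldType.
Implicit Types (X Y Z : 'M[C]_2).

(** The product of two volumes is the determinant of the mutual pairings, here with normalising
    factor -2. *)
Lemma sl2_gram P Q S X Y Z :
  P \in sl2 C -> Q \in sl2 C -> S \in sl2 C ->
  X \in sl2 C -> Y \in sl2 C -> Z \in sl2 C ->
  tform (bracket X Y) Z * tform (bracket P Q) S =
  - 2 * (tform X P * (tform Y Q * tform Z S - tform Y S * tform Z Q)
         - tform X Q * (tform Y P * tform Z S - tform Y S * tform Z P)
         + tform X S * (tform Y P * tform Z Q - tform Y Q * tform Z P)).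
Proof.
move=> /sl2_mxP[p1 [p2 [p3 ->]]] /sl2_mxP[q1 [q2 [q3 ->]]].
move=> /sl2_mxP[s1 [s2 [s3 ->]]] /sl2_mxP[x1 [x2 [x3 ->]]].
move=> /sl2_mxP[y1 [y2 [y3 ->]]] /sl2_mxP[z1 [z2 [z3 ->]]].
by rewrite !sl2_mxE; ring.
Qed.

Section NullPair.
Variables sm sp : 'M[C]_2.
Hypotheses (sl_sm : sm \in sl2 C) (sl_sp : sp \in sl2 C).
Hypotheses (sm_null : tform sm sm = 0) (sp_null : tform sp sp = 0).
Hypothesis sp_sm : tform sp sm = 1.

Local Notation s3 := (bracket sp sm).

Let sl_s3 : s3 \in sl2 C. Proof. exact: bracket_sl2. Qed.

Lemma tform_s3_s3 : tform s3 s3 = 2.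
Proof.
by rewrite tform_bracket_bracket // sp_null sm_null (tformC sm) sp_sm; ring.
Qed.

Lemma bracket_s3_sm : bracket s3 sm = - 2 *: sm.
Proof.
rewrite bracketN (bracketN sm sp) -[- bracket sm sp]scaleN1r bracketZr.
rewrite double_bracket // sm_null (tformC sm) sp_sm scale0r scale1r sub0r.
by rewrite scaleN1r opprK scalerN scaleNr.
Qed.

Lemma bracket_s3_sp : bracket s3 sp = 2 *: sp.
Proof.
by rewrite bracketN double_bracket // sp_null sp_sm scale0r scale1r sub0r scalerN opprK.
Qed.

(** The triple identity for [sp], [sm], [s3], whose volume is [tform s3 s3], that is 2. *)
Lemma null_pair_decomp X : X \in sl2 C ->
  X = (2^-1 * tform X s3) *: s3 + tform X sm *: sp + tform X sp *: sm.
Proof.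
move=> sX; have := sl2_triple_identity sl_sp sl_sm sl_s3 sX.
rewrite tform_s3_s3 bracket_s3_sp (bracketN s3) bracket_s3_sm scaleNr opprK.
move=> /(congr1 ( *:%R 2^-1)); rewrite scalerA mulVf ?pnatr_eq0 // scale1r => eqX.
rewrite [LHS]eqX !scalerDr !scalerA addrC [X in _ + X]addrC addrA.
by congr (_ + _ *: _ + _ *: _); field.
Qed.

Lemma tform_coord X Y : X \in sl2 C -> Y \in sl2 C ->
  tform X Y = 2 * (2^-1 * tform X s3) * (2^-1 * tform Y s3)
              + tform X sm * tform Y sp + tform X sp * tform Y sm.
Proof.
move=> sX sY; rewrite {1}(null_pair_decomp sX) !tformDl !tformZl.
by rewrite !(tformC _ Y); field.
Qed.

Lemma tform_bracket_coord X Y Z :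
  X \in sl2 C -> Y \in sl2 C -> Z \in sl2 C ->
  tform (bracket X Y) Z =
  2 * (tform X sm * (tform Y sp * (2^-1 * tform Z s3) - 2^-1 * tform Y s3 * tform Z sp)
       - tform X sp * (tform Y sm * (2^-1 * tform Z s3) - 2^-1 * tform Y s3 * tform Z sm)
       + 2^-1 * tform X s3 * (tform Y sm * tform Z sp - tform Y sp * tform Z sm)).
Proof.
move=> sX sY sZ; have := sl2_gram sl_sp sl_sm sl_s3 sX sY sZ.
rewrite tform_s3_s3 => eqf; apply: (mulIf (x := 2)); first by rewrite pnatr_eq0.
by rewrite eqf; field.
Qed.

Lemma null_pair_standard : standard_basis sm sp s3.
Proof.
have tr3 X : tform X s3 = tform s3 X by exact: tformC.
split=> //; first last.
- by rewrite tformC tform_bracketr tformC tform_bracketl.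
rewrite /basis_of; apply/andP; split.
  rewrite eqEsubv; apply/andP; split.
    by apply/span_subvP => v; rewrite !inE => /or3P[] /eqP->.
  apply/subvP => X sX; rewrite (null_pair_decomp sX).
  by rewrite !memvD ?memvZ ?memv_span // !inE eqxx ?orbT.
apply/(@freeP _ _ _ [tuple sm; sp; s3]) => k; rewrite !big_ord_recl big_ord0 /= addr0 => k0.
(* Pairing a vanishing combination with [sp], [sm] and [s3] isolates its three coefficients, the
   last one up to the factor 2. *)
have pair Y : tform (k ord0 *: sm + (k (lift ord0 ord0) *: sp
    + k (lift ord0 (lift ord0 ord0)) *: s3)) Y = 0.
  by rewrite k0 /tform mul0mx mxtrace0.
move: (pair sp) (pair sm) (pair s3).
rewrite !tformDl !tformZl sp_null sm_null tform_s3_s3 tform_bracketl.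
rewrite tform_bracketr (tformC sm sp) sp_sm !(tformC _ s3) tform_bracketl tform_bracketr.
rewrite !mulr0 !addr0 !add0r !mulr1 => k0' k1' /eqP.
rewrite mulf_eq0 pnatr_eq0 orbF => /eqP k2'.
case=> [[|[|[|//]]] hi].
- by rewrite -k0'; congr k; apply: val_inj.
- by rewrite -k1'; congr k; apply: val_inj.
- by rewrite -k2'; congr k; apply: val_inj.
Qed.
End NullPair.
End StandardBasis.

(** * Points of the quadrics and their eigenlines *)

Section Quadrics.
Variable C : numFieldType.
Implicit Types (X Y Z A v w : 'M[C]_2) (a t : C).

Lemma standard_basis_null_pair (sm sp s3 : 'M[C]_2) : standard_basis sm sp s3 ->
  [/\ sm \in sl2 C /\ sp \in sl2 C, tform sm sm = 0, tform sp sp = 0,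
      tform sp sm = 1 & s3 = bracket sp sm].
Proof.
case=> basis [sm0 sp0] _ spsm def3; split=> //.
have /andP[/eqP <- _] := basis.
by split; apply: memv_span; rewrite !inE eqxx ?orbT.
Qed.

(** Treats both kinds of quadric through a spanning vector w, which is zero when there is no second
    component; isotropy replaces nilpotency. *)
Lemma in_quadric_vline a A w :
  in_quadric a (QPoint A <[w]>%VS) <->
  if a == 0 then [/\ w \in sl2 C, w != 0, tform w w = 0 & A \in <[w]>%VS]
  else [/\ A \in sl2 C, tform A A = a & w = 0].
Proof.
rewrite /in_quadric; case: ifP => _ /=; last first.
  split=> [[sA tA] | [sA tA ->]].
    by move=> l0; split=> //; apply/eqP; rewrite -memv0 -l0 memv_line.
  by split=> //.
split=> [[[N [sN N0 nN eqN]] Aw] | [sw w0 tw Aw]].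
  have /vlineP[c defw] : w \in <[N]>%VS by rewrite -eqN memv_line.
  split=> //.
  - by rewrite defw memvZ.
  - apply: contraNneq N0 => w0; have : N \in <[w]>%VS by rewrite eqN memv_line.
    by rewrite w0 => /vlineP[k ->]; rewrite scaler0.
  - by rewrite defw tformZl tformZr (nilpotent_sl2P sN).1 ?mulr0.
by split=> //; exists w; split=> //; apply/nilpotent_sl2P.
Qed.

Lemma in_quadric_line a p : in_quadric a p -> exists w, line p = <[w]>%VS.
Proof.
rewrite /in_quadric; case: ifP => _ [].
  by case=> N [_ _ _ ->] _; exists N.
by move=> _ _ ->; exists 0.
Qed.

Lemma in_quadric_mat a p :
  in_quadric a p -> mat p \in sl2 C /\ tform (mat p) (mat p) = a.
Proof.
move=> Qp; have [w lw] := in_quadric_line Qp.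
case: p lw Qp => A l /= -> /in_quadric_vline; case: ifP => [/eqP-> | _ []//].
case=> sw _ tw /vlineP[c ->].
by rewrite memvZ // tformZl tformZr tw !mulr0.
Qed.

(** For t nonzero, invariance of the form gives t times each of the two pairings as the pairing of a
    bracket with one of its own arguments, hence zero. For a = 0 also t = 0, and the matrix and v
    lie on one isotropic line, so they commute. *)
Lemma sigma_line_eigen a p t v :
  t ^+ 2 = 2 * a -> in_quadric a p -> sigma_line a p t v ->
  [/\ v \in sl2 C, tform v v = 0, tform (mat p) v = 0
    & bracket (mat p) v = t *: v].
Proof.
move=> ta Qp; have [w lw] := in_quadric_line Qp; rewrite /sigma_line /=.
case: p lw Qp => A l /= -> /in_quadric_vline; case: ifP => [/eqP a0 | a0].
  case=> sw _ tw /vlineP[c ->] /vlineP[d ->].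
  rewrite a0 mulr0 in ta; move/eqP: ta; rewrite sqrf_eq0 => /eqP->.
  rewrite memvZ // !tformZl !tformZr tw !mulr0; split=> //.
  by rewrite bracketZl bracketZr /bracket subrr !scaler0 scale0r.
case=> sA _ _ [sv Av]; have t0 : t != 0.
  by apply: contraFneq a0 => t0; move/eqP: ta; rewrite t0 expr0n eq_sym mulf_eq0 pnatr_eq0.
split=> //; apply: (mulfI t0); rewrite mulr0.
  by rewrite -tformZl -Av tform_bracketr.
by rewrite -tformZr -Av tformC tform_bracketl.
Qed.

Lemma sigma_lineZ a p t c v :
  sigma_line a p t v -> sigma_line a p t (c *: v).
Proof.
rewrite /sigma_line /=; case: ifP => _; first exact: memvZ.
by case=> sv Av; rewrite memvZ // bracketZr Av !scalerA mulrC.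
Qed.

End Quadrics.

(** * The accompanying basis and the values it forces on the matrix elements *)

Section AccompanyingBasis.
Variables (C : numFieldType) (n : nat) (a : 'I_n.+1 -> C) (s0 s1 : C).
Hypotheses (s0E : s0 ^+ 2 = 2 * a ord0) (s1E : s1 ^+ 2 = 2 * a (inord n.-1)).

Lemma accompanying_exists x :
  Utilde a s0 s1 x -> accompanying a s0 s1 x (acc_basis a s0 s1 x).
Proof.
case=> -[Qx _ _] [sm [sp [[_ Lm] [_ Lp] mp mA]]].
have s0N : (- s0) ^+ 2 = 2 * a ord0 by rewrite sqrrN.
have [sl_m m0 _ _] := sigma_line_eigen s0N (Qx _) Lm.
have [sl_p p0 _ _] := sigma_line_eigen s1E (Qx _) Lp.
pose c := tform sm (mat (x ord_max)).
(* The first factor makes the pairing of m with A^(n) equal to 1, the second then makes the pairing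
   of p with m equal to 1. *)
pose m := c^-1 *: sm; pose p := (c / tform sm sp) *: sp.
apply: (@xgetPex _ _ [set b | accompanying a s0 s1 x b]).
exists (m, p, bracket p m); split.
- apply: null_pair_standard; rewrite ?memvZ // ?tformZl ?tformZr ?m0 ?p0 ?mulr0 //.
  by rewrite (tformC sp); field; rewrite mA.
- exact: sigma_lineZ.
- exact: sigma_lineZ.
- by rewrite tformZl mulVf.
Qed.

Local Notation beta := (beta_fun a s0 s1).
Local Notation q := (q_fun a s0 s1).
Local Notation q' := (q'_fun a s0 s1).

Lemma Utilde_sum_tform x Y : Utilde a s0 s1 x -> \sum_k tform (mat (x k)) Y = 0.
Proof.
case=> -[_ x0 _] _; have <- : tform (\sum_k mat (x k)) Y = \sum_k tform (mat (x k)) Y.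
  by rewrite /tform mulmx_suml raddf_sum.
by rewrite x0 /tform mul0mx mxtrace0.
Qed.

(** The sums vanish because the A^(k) add up to zero. The diagonal entries come from moving A^(0) or
    A^(n-1) into the bracket defining [sigma_3] cyclically and using the eigenvector equations. *)
Lemma Utilde_coords x : Utilde a s0 s1 x ->
  [/\ [/\ \sum_k beta k x = 0, \sum_k q k x = 0 & \sum_k q' k x = 0],
      [/\ beta ord0 x = s0 / 2 & q ord0 x = 0],
      [/\ beta (inord n.-1) x = s1 / 2 & q' (inord n.-1) x = 0]
    & q ord_max x = 1].
Proof.
move=> Ux; have [[Qx _ _] _] := Ux.
split; first by split; rewrite -?mulr_sumr (Utilde_sum_tform _ Ux) ?mulr0.
all: have := accompanying_exists Ux; rewrite /beta_fun /q_fun /q'_fun.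
all: rewrite /sigma_3 /sigma_minus /sigma_plus.
all: case: (acc_basis a s0 s1 x) => -[sm sp] s3 /= [sb Lm Lp mA].
all: have [[sl_m sl_p] m0 p0 pm def3] := standard_basis_null_pair sb.
- have s0N : (- s0) ^+ 2 = 2 * a ord0 by rewrite sqrrN.
  have [_ _ A0m eigm] := sigma_line_eigen s0N (Qx _) Lm.
  split=> //; rewrite -/(tform _ _) tformC def3 tform_cycle bracketN eigm.
  by rewrite scaleNr opprK tformZl tformC pm mulr1 mulrC.
- have [_ _ A1p eigp] := sigma_line_eigen s1E (Qx _) Lp.
  split=> //; rewrite -/(tform _ _) tformC def3 2!tform_cycle eigp.
  by rewrite tformZl pm mulr1 mulrC.
- by rewrite -/(tform _ _) tformC.
Qed.

Lemma a_fun_coords x i j : Utilde a s0 s1 x ->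
  a_fun i j x = 2 * beta i x * beta j x + q i x * q' j x + q' i x * q j x.
Proof.
move=> Ux; have [[Qx _ _] _] := Ux; have := accompanying_exists Ux.
have sA l : mat (x l) \in sl2 C by case: (in_quadric_mat (Qx l)).
rewrite /beta_fun /q_fun /q'_fun /sigma_3 /sigma_minus /sigma_plus.
case: (acc_basis a s0 s1 x) => -[sm sp] s3 /= [sb _ _ _].
have [[sl_m sl_p] m0 p0 pm ->] := standard_basis_null_pair sb.
by apply: tform_coord ; rewrite ?sA.
Qed.

Lemma f_fun_coords x i j k : Utilde a s0 s1 x ->
  f_fun i j k x =
  2 * (q i x * (q' j x * beta k x - beta j x * q' k x)
       - q' i x * (q j x * beta k x - beta j x * q k x)
       + beta i x * (q j x * q' k x - q' j x * q k x)).
Proof.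
move=> Ux; have [[Qx _ _] _] := Ux; have := accompanying_exists Ux.
have sA l : mat (x l) \in sl2 C by case: (in_quadric_mat (Qx l)).
rewrite /beta_fun /q_fun /q'_fun /sigma_3 /sigma_minus /sigma_plus.
case: (acc_basis a s0 s1 x) => -[sm sp] s3 /= [sb _ _ _].
have [[sl_m sl_p] m0 p0 pm ->] := standard_basis_null_pair sb.
by apply: tform_bracket_coord ; rewrite ?sA.
Qed.

Lemma a_fun_diag x i : Utilde a s0 s1 x -> a_fun i i x = a i.
Proof. by case=> -[Qx _ _] _; case: (in_quadric_mat (Qx i)). Qed.

End AccompanyingBasis.

(** * Unipotent conjugation inside a quadric *)

Section Shears.
Variable C : numFieldType.
Implicit Types (X Y A w u : 'M[C]_2) (a t : C).

Lemma in_quadric_conj a A w u u' : u *m u' = 1%:M ->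
  in_quadric a (QPoint A <[w]>%VS) ->
  in_quadric a (QPoint (u *m A *m u') <[u *m w *m u']>%VS).
Proof.
move=> uu'; have u'u := mulmx1C uu'.
have conj_sl2 X : X \in sl2 C -> u *m X *m u' \in sl2 C.
  by rewrite !mem_sl2 mxtrace_mulC mulmxA u'u mul1mx.
have conj_tform X Y : tform (u *m X *m u') (u *m Y *m u') = tform X Y.
  by rewrite /tform !mulmxA -(mulmxA _ u') u'u mulmx1 mxtrace_mulC !mulmxA u'u mul1mx.
rewrite !in_quadric_vline; case: ifP => _.
  case=> sw w0 tw /vlineP[c ->]; split; rewrite ?conj_sl2 ?conj_tform //.
    apply: contraNneq w0 => /(congr1 (fun X => u' *m X *m u)).
    by rewrite !mulmxA u'u mul1mx -mulmxA u'u mulmx1 mulmx0 mul0mx => ->.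
  by apply/vlineP; exists c; rewrite -scalemxAr -scalemxAl.
by case=> sA tA ->; rewrite conj_sl2 // conj_tform mulmx0 mul0mx.
Qed.

(** For isotropic X the square of X is zero, so this is exp(tX): conjugation by it is polynomial in
    t. *)
Definition shear X t : 'M[C]_2 := 1%:M + t *: X.

Lemma sandwich_sl2 X Y : X \in sl2 C -> Y \in sl2 C ->
  X *m Y *m X = tform X Y *: X - (2^-1 * tform X X) *: Y.
Proof.
move=> /sl2_mxP[p1 [p2 [p3 ->]]] /sl2_mxP[q1 [q2 [q3 ->]]].
rewrite !sl2_mxE; apply/matrixP => i j.
rewrite !mxE !big_ord_recl big_ord0 !mxE !big_ord_recl !big_ord0 !mxE /=.
by case: eqP => _; case: eqP => _ /=; field.
Qed.

Variable X : 'M[C]_2.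
Hypotheses (sX : X \in sl2 C) (X0 : tform X X = 0).

Lemma shearK t : shear X t *m shear X (- t) = 1%:M.
Proof.
rewrite /shear mulmxDl !mulmxDr !mul1mx mulmx1 -scalemxAl -scalemxAr.
have -> : X *m X = 0 by rewrite -[X *m X]/(X ^+ 2) sl2_sqr // X0 mulr0 raddf0.
by rewrite !scaler0 addr0 scaleNr -addrA addNr addr0.
Qed.

(** Cyclicity of the trace moves the conjugation onto Y, where [sandwich_sl2] reduces the quadratic
    term to a multiple of X. *)
Lemma tform_shear A Y t : Y \in sl2 C ->
  tform (shear X t *m A *m shear X (- t)) Y =
  tform A Y - t * tform A (bracket X Y) - t ^+ 2 * tform X Y * tform A X.
Proof.
move=> sY; have -> : tform (shear X t *m A *m shear X (- t)) Y
    = tform A (shear X (- t) *m Y *m shear X t).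
  by rewrite /tform -!mulmxA mxtrace_mulC !mulmxA.
have -> : shear X (- t) *m Y *m shear X t
    = Y + (- t *: bracket X Y + - (t ^+ 2 * tform X Y) *: X).
  rewrite /shear !mulmxDl !mulmxDr !mul1mx !mulmx1 -!scalemxAl -!scalemxAr.
  rewrite sandwich_sl2 // X0 mulr0 scale0r subr0 /bracket !scalerA.
  move: (X *m Y) (Y *m X) (tform X Y) => P Q c.
  have eq_entry (y u v z : C) :
      y + t * v + (- t * u + - t * t * c * z)
      = y + (- t * (u - v) + - (t ^+ 2 * c) * z) by ring.
  by apply/matrixP => i j; rewrite !mxE; apply: eq_entry.
by rewrite 2!tformDr !tformZr; ring.
Qed.

Lemma closed_mx_shear (K : (C -> C) -> Prop) A :
  ring_closed K -> K id -> closed_mx K (fun t => shear X t *m A *m shear X (- t)).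
Proof.
move=> cl Kid; apply: (closed_mxM cl).
  apply: (closed_mxM cl); last exact: (closed_mx_cst cl).
  apply: (closed_mxD cl); first exact: (closed_mx_cst cl).
  by apply: (closed_mxZ cl); last exact: (closed_mx_cst cl).
apply: (closed_mxD cl); first exact: (closed_mx_cst cl).
by apply: (closed_mxZ cl); [exact: (ring_closedN cl) | exact: (closed_mx_cst cl)].
Qed.

End Shears.

(** * Rational expressions and the coordinates in the accompanying basis *)

Section RationalOn.
Variables (F : fieldType) (T : Type) (V : set T) (I : finType) (h : I -> T -> F).
Implicit Types f g : T -> F.

(** The set V is fixed once for all g, so sums and products need no intersection of domains;
    openness and density of V are checked separately. *)
Definition rational_on g : Prop :=
  exists P Q : {mpoly F[#|I|]}, forall x, V x ->
    let v := fun l => h (enum_val l) x in Q.@[v] != 0 /\ g x = P.@[v] / Q.@[v].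

Lemma rational_on_eq f g :
  (forall x, V x -> g x = f x) -> rational_on f -> rational_on g.
Proof. by move=> gf [P [Q PQ]]; exists P, Q => x Vx; rewrite gf //; apply: PQ. Qed.

Lemma rational_on_cst c : rational_on (fun=> c).
Proof. by exists c%:MP, 1 => x _ /=; rewrite meval1 mevalC oner_neq0 divr1. Qed.

Lemma rational_on_gen i : rational_on (h i).
Proof.
by exists 'X_(enum_rank i), 1 => x _ /=; rewrite meval1 mevalXU oner_neq0 divr1 enum_rankK.
Qed.

Lemma rational_onD f g :
  rational_on f -> rational_on g -> rational_on (fun x => f x + g x).
Proof.
move=> [P [Q PQ]] [P' [Q' PQ']]; exists (P * Q' + P' * Q), (Q * Q') => x Vx /=.
have [Q0 ->] := PQ x Vx; have [Q'0 ->] := PQ' x Vx.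
by rewrite !(mevalD, mevalM) mulf_neq0 // addf_div.
Qed.

Lemma rational_onM f g :
  rational_on f -> rational_on g -> rational_on (fun x => f x * g x).
Proof.
move=> [P [Q PQ]] [P' [Q' PQ']]; exists (P * P'), (Q * Q') => x Vx /=.
have [Q0 ->] := PQ x Vx; have [Q'0 ->] := PQ' x Vx.
by rewrite !mevalM mulf_neq0 // mulf_div.
Qed.

Lemma rational_onV f : (forall x, V x -> f x != 0) ->
  rational_on f -> rational_on (fun x => (f x)^-1).
Proof.
move=> f0 [P [Q PQ]]; exists Q, P => x Vx /=; have [Q0 fE] := PQ x Vx.
by move: (f0 x Vx); rewrite fE mulf_eq0 invr_eq0 negb_or => /andP[P0 _]; rewrite invf_div.
Qed.

Lemma rational_on_closed : ring_closed rational_on.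
Proof.
split; [move=> f g fg; apply: rational_on_eq => x _; exact/esym/fg | | |].
- exact: rational_on_cst.
- exact: rational_onD.
- exact: rational_onM.
Qed.

Definition rational_onN := ring_closedN rational_on_closed.
Definition rational_onB := ring_closedB rational_on_closed.
Definition rational_on_sum := ring_closed_sum rational_on_closed.

End RationalOn.

(** * The invariants as rational functions of the matrix elements *)

Section Coordinates.
Variables (C : numFieldType) (n : nat) (a : 'I_n.+1 -> C) (s0 s1 : C).
Hypotheses (s0E : s0 ^+ 2 = 2 * a ord0) (s1E : s1 ^+ 2 = 2 * a (inord n.-1)).
Hypothesis hn : (2 <= n)%N.

Local Notation U := (Utilde a s0 s1).
Local Notation beta := (beta_fun a s0 s1).
Local Notation q := (q_fun a s0 s1).
Local Notation q' := (q'_fun a s0 s1).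
Local Notation penult := (inord n.-1 : 'I_n.+1).

Lemma val_penult : penult = n.-1 :> nat.
Proof. by rewrite inordK // ltnS leq_pred. Qed.

Lemma index_cases (k : 'I_n.+1) :
  [\/ k = ord0, k = penult, k = ord_max | (1 <= k <= n - 2)%N].
Proof.
have [k0|k0] := eqVneq (k : nat) 0%N; first by constructor 1; apply: val_inj.
have [k1|k1] := eqVneq (k : nat) n.-1.
  by constructor 2; apply: val_inj; rewrite /= val_penult.
have [k2|k2] := eqVneq (k : nat) n; first by constructor 3; apply: val_inj.
constructor 4; have := ltn_ord k; lia.
Qed.

Lemma ord0_neq_penult : ord0 != penult.
Proof. by apply/eqP => /(congr1 val) /=; rewrite val_penult; lia. Qed.

Lemma ord0_neq_max : ord0 != ord_max :> 'I_n.+1.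
Proof. by apply/eqP => /(congr1 val) /=; lia. Qed.

Lemma penult_neq_max : penult != ord_max.
Proof. by apply/eqP => /(congr1 val) /=; rewrite val_penult; lia. Qed.

Lemma sum0_isolate (f : 'I_n.+1 -> C) j : \sum_k f k = 0 ->
  f j = - \sum_(k | k != j) f k.
Proof. by rewrite (bigD1 j) //= => /eqP; rewrite addr_eq0 => /eqP. Qed.

Section Elements.
Local Notation rational := (rational_on U (matrix_elements a s0 s1)).

Lemma rational_beta_inner (k : 'I_n.+1) : (1 <= k <= n - 2)%N -> rational (beta k).
Proof. by move=> hk; apply: rational_on_gen (inl (inl (Sub k hk : inner n))). Qed.

Lemma rational_q_inner (k : 'I_n.+1) : (1 <= k <= n - 2)%N -> rational (q k).
Proof. by move=> hk; apply: rational_on_gen (inl (inr (Sub k hk : inner n))). Qed.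

Lemma rational_q'_inner (k : 'I_n.+1) : (1 <= k <= n - 2)%N -> rational (q' k).
Proof. by move=> hk; apply: rational_on_gen (inr (Sub k hk : inner n)). Qed.

(** Each family beta, q, q' has just one member that is neither inner nor otherwise known, at index
    n, n-1 and 0 respectively; the vanishing sum supplies it. *)
Lemma rational_isolate (f : 'I_n.+1 -> conf C n -> C) j :
  (forall x, U x -> \sum_k f k x = 0) ->
  (forall k, k != j -> rational (f k)) -> rational (f j).
Proof.
move=> sum0 rf; apply: rational_on_eq (rational_onN (rational_on_sum _ rf)).
by move=> x Ux; apply: sum0_isolate (sum0 x Ux).
Qed.

Lemma rational_beta k : rational (beta k).
Proof.
have rational_beta_notmax j : j != ord_max -> rational (beta j).
  case: (index_cases j) => [->|->|->|/rational_beta_inner//] jmax.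
  - apply: rational_on_eq (rational_on_cst _ _ (s0 / 2)) => x Ux.
    by have [_ []] := Utilde_coords s0E s1E Ux.
  - apply: rational_on_eq (rational_on_cst _ _ (s1 / 2)) => x Ux.
    by have [_ _ []] := Utilde_coords s0E s1E Ux.
  - by rewrite eqxx in jmax.
have [->|] := eqVneq k ord_max; last exact: rational_beta_notmax.
apply: rational_isolate => // x Ux.
by have [[]] := Utilde_coords s0E s1E Ux.
Qed.

Lemma rational_q k : rational (q k).
Proof.
have rational_q_notpenult j : j != penult -> rational (q j).
  case: (index_cases j) => [->|->|->|/rational_q_inner//] jmax.
  - apply: rational_on_eq (rational_on_cst _ _ 0) => x Ux.
    by have [_ []] := Utilde_coords s0E s1E Ux.
  - by rewrite eqxx in jmax.
  - apply: rational_on_eq (rational_on_cst _ _ 1) => x Ux.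
    by have [_ _ _] := Utilde_coords s0E s1E Ux.
have [->|] := eqVneq k penult; last exact: rational_q_notpenult.
apply: rational_isolate => // x Ux.
by have [[]] := Utilde_coords s0E s1E Ux.
Qed.

(** The quadric equation of A^(n) is linear in its q' entry because its q entry is 1. *)
Lemma q'_max x : U x -> q' ord_max x = a ord_max / 2 - beta ord_max x ^+ 2.
Proof.
move=> Ux; have := a_fun_diag ord_max Ux.
rewrite (a_fun_coords s0E s1E) //; have [_ _ _ ->] := Utilde_coords s0E s1E Ux.
by move=> <-; field.
Qed.

Lemma rational_q' k : rational (q' k).
Proof.
have rational_q'_not0 j : j != ord0 -> rational (q' j).
  case: (index_cases j) => [->|->|->|/rational_q'_inner//] jmax.
  - by rewrite eqxx in jmax.
  - apply: rational_on_eq (rational_on_cst _ _ 0) => x Ux.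
    by have [_ _ []] := Utilde_coords s0E s1E Ux.
  - apply: rational_on_eq q'_max _.
    apply: rational_onB; first exact: rational_on_cst.
    by apply: rational_onM; apply: rational_beta.
have [->|] := eqVneq k ord0; last exact: rational_q'_not0.
apply: rational_isolate => // x Ux.
by have [[]] := Utilde_coords s0E s1E Ux.
Qed.

Local Ltac rational_tac :=
  first [ exact: rational_beta | exact: rational_q | exact: rational_q'
        | exact: rational_on_cst | apply: rational_onB | apply: rational_onD
        | apply: rational_onM ].

Lemma rational_a_fun i j : rational (a_fun i j).
Proof.
apply: rational_on_eq (fun x => @a_fun_coords _ _ _ _ _ s0E s1E x i j) _.
by do !rational_tac.
Qed.

Lemma rational_f_fun i j k : rational (f_fun i j k).
Proof.
apply: rational_on_eq (fun x => @f_fun_coords _ _ _ _ _ s0E s1E x i j k) _.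
by do !rational_tac.
Qed.

End Elements.
End Coordinates.

(** * Matrix elements as rational functions of the invariants *)

Section Recovery.
Variables (C : numFieldType) (n : nat) (a : 'I_n.+1 -> C) (s0 s1 : C).
Hypotheses (s0E : s0 ^+ 2 = 2 * a ord0) (s1E : s1 ^+ 2 = 2 * a (inord n.-1)).

Local Notation U := (Utilde a s0 s1).
Local Notation beta := (beta_fun a s0 s1).
Local Notation q := (q_fun a s0 s1).
Local Notation q' := (q'_fun a s0 s1).
Local Notation penult := (inord n.-1 : 'I_n.+1).

Definition gram (x : conf C n) : C :=
  a_fun ord0 ord0 x * a_fun ord_max ord_max x - a_fun ord0 ord_max x ^+ 2.

(* [q_num k] and [beta_num k] are the pairings of A^(k) and of [A^(k), A^(n)]
   with (ad_{A^(0)} - s0) ad_{A^(0)} A^(n) = 2 gram sigma_-. *)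
Definition q_num k (x : conf C n) : C :=
  2 * (a_fun ord0 ord0 x * a_fun ord_max k x - a_fun ord0 ord_max x * a_fun ord0 k x)
  - s0 * f_fun ord0 ord_max k x.

Definition beta_num k (x : conf C n) : C :=
  - (2 * a_fun ord0 ord_max x * f_fun k ord_max ord0 x)
  - 2 * s0 * (a_fun k ord_max x * a_fun ord_max ord0 x
              - a_fun k ord0 x * a_fun ord_max ord_max x).

(** On [U] this is twice the square of the Gram determinant times the q entry of A^(n-1), but
    written in the invariants alone, so that its nonvanishing is visibly an open condition. *)
Definition denominator (x : conf C n) : C := gram x * q_num penult x.

Lemma q_numE k x : U x -> q_num k x = 2 * gram x * q k x.
Proof.
move=> Ux; rewrite /q_num /gram !(a_fun_coords s0E s1E) // (f_fun_coords s0E s1E) //.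
have [_ [-> ->] _ ->] := Utilde_coords s0E s1E Ux.
by field.
Qed.

Lemma beta_numE k x : U x ->
  beta_num k x = 4 * gram x * (beta k x - beta ord_max x * q k x).
Proof.
move=> Ux; rewrite /beta_num /gram !(a_fun_coords s0E s1E) // (f_fun_coords s0E s1E) //.
have [_ [-> ->] _ ->] := Utilde_coords s0E s1E Ux.
by field.
Qed.

Local Notation V := [set x | U x /\ denominator x != 0].
Local Notation rational := (rational_on V (@invariants C n)).

Lemma denominator_neq0 x : V x -> gram x != 0 /\ q penult x != 0.
Proof.
by case=> Ux; rewrite /denominator q_numE // !mulf_eq0 !negb_or => /and3P[? /andP[]].
Qed.

Lemma rational_inv_a_fun i j : rational (a_fun i j).
Proof. exact: rational_on_gen (inl (i, j)). Qed.

Lemma rational_inv_f_fun i j k : rational (f_fun i j k).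
Proof. exact: rational_on_gen (inr (i, j, k)). Qed.

Local Ltac rational_tac :=
  first [ exact: rational_inv_a_fun | exact: rational_inv_f_fun
        | exact: rational_on_cst | apply: rational_onB | apply: rational_onD
        | apply: rational_onN | apply: rational_onM ].

Lemma rational_gram : rational gram.
Proof. by rewrite /gram; do !rational_tac. Qed.

Lemma rational_gramV : rational (fun x => (gram x)^-1).
Proof. by apply: rational_onV rational_gram => x /denominator_neq0[]. Qed.

Lemma rational_q_num k : rational (q_num k).
Proof. by rewrite /q_num; do !rational_tac. Qed.

Lemma rational_beta_num k : rational (beta_num k).
Proof. by rewrite /beta_num; do !rational_tac. Qed.

Lemma rational_inv_q k : rational (q k).
Proof.
have : rational (fun x => q_num k x * (2^-1 * (gram x)^-1)).
  apply: rational_onM (rational_q_num k) _.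
  exact: rational_onM (rational_on_cst _ _ 2^-1) rational_gramV.
apply: rational_on_eq => x Vx; have [g0 _] := denominator_neq0 Vx.
by have [Ux _] := Vx; rewrite q_numE //; field.
Qed.

(* At k = n - 1 the value of beta is known to be s1 / 2. *)
Lemma rational_inv_beta_max : rational (beta ord_max).
Proof.
have : rational (fun x =>
    (s1 / 2 - beta_num penult x * (4^-1 * (gram x)^-1)) * (q penult x)^-1).
  apply: rational_onM; last first.
    by apply: rational_onV (rational_inv_q _) => x /denominator_neq0[].
  apply: rational_onB; first exact: rational_on_cst.
  apply: rational_onM (rational_beta_num _) _.
  exact: rational_onM (rational_on_cst _ _ 4^-1) rational_gramV.
apply: rational_on_eq => x Vx; have [g0 q0] := denominator_neq0 Vx.
have [Ux _] := Vx; rewrite beta_numE //.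
have [_ _ [-> _] _] := Utilde_coords s0E s1E Ux.
by field; rewrite g0 q0.
Qed.

Lemma rational_inv_beta k : rational (beta k).
Proof.
have : rational (fun x =>
    beta_num k x * (4^-1 * (gram x)^-1) + beta ord_max x * q k x).
  apply: rational_onD; last exact: rational_onM rational_inv_beta_max (rational_inv_q k).
  apply: rational_onM (rational_beta_num _) _.
  exact: rational_onM (rational_on_cst _ _ 4^-1) rational_gramV.
apply: rational_on_eq => x Vx; have [g0 _] := denominator_neq0 Vx.
by have [Ux _] := Vx; rewrite beta_numE //; field.
Qed.

(** With the q entry of A^(n) equal to 1, the coordinate formula for a_kn is solved for the q' entry
    of A^(k). *)
Lemma rational_inv_q' k : rational (q' k).
Proof.
have : rational (fun x => a_fun k ord_max x - 2 * beta k x * beta ord_max x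
    - (a ord_max / 2 - beta ord_max x * beta ord_max x) * q k x).
  by do !first [ exact: rational_inv_beta | exact: rational_inv_q | rational_tac ].
apply: rational_on_eq => x [Ux _]; rewrite (a_fun_coords s0E s1E) //.
rewrite (q'_max s0E s1E) //; have [_ _ _ ->] := Utilde_coords s0E s1E Ux.
by field.
Qed.

End Recovery.

(** * Zariski density *)

Section ZariskiOpen.
Variables (C : numFieldType) (n : nat).

Definition coord_polynomial (g : conf C n * ('I_n.+1 -> 'M[C]_2) -> C) : Prop :=
  exists p : {mpoly C[#|coord_idx n|]},
    forall z, g z = p.@[coords (fun k => mat (z.1 k)) z.2].

Lemma coord_polynomial_closed : ring_closed coord_polynomial.
Proof.
split=> [f g fg [P fP] | c | f g [P fP] [Q gQ] | f g [P fP] [Q gQ]].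
- by exists P => z; rewrite -fg.
- by exists c%:MP => z; rewrite mevalC.
- by exists (P + Q) => z; rewrite mevalD fP gQ.
- by exists (P * Q) => z; rewrite mevalM fP gQ.
Qed.

Lemma coord_polynomial_mat k : closed_mx coord_polynomial (fun z => mat (z.1 k)).
Proof.
move=> i j; exists 'X_(enum_rank ((false, k, i, j) : coord_idx n)) => z.
by rewrite mevalXU /coords enum_rankK.
Qed.

Lemma coord_polynomial_a_fun i j : coord_polynomial (fun z => a_fun i j z.1).
Proof.
apply: (closed_mx_tr coord_polynomial_closed).
by apply: (closed_mxM coord_polynomial_closed); apply: coord_polynomial_mat.
Qed.

Lemma coord_polynomial_f_fun i j k : coord_polynomial (fun z => f_fun i j k z.1).
Proof.
have cl := coord_polynomial_closed; have cm := coord_polynomial_mat.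
apply: (closed_mx_tr cl); apply: (closed_mxM cl) => //.
by apply: (closed_mxD cl); last apply: (closed_mxN cl); apply: (closed_mxM cl).
Qed.

(** A polynomial whose values depend on the matrices only is homogeneous of degree 0 in every
    spanning vector, hence admissible for the topology. *)
Lemma zariski_open_nonvanishing (S : set (conf C n)) (g : conf C n -> C) :
  (forall x, S x -> exists w, forall k, line (x k) = <[w k]>%VS) ->
  coord_polynomial (fun z => g z.1) -> zariski_open_in S [set x | S x /\ g x != 0].
Proof.
move=> lineS [p gp]; split; first by move=> x [].
exists [set p].
  move=> _ ->; exists (fun=> 0%N) => c A w.
  rewrite big1 // mul1r.
  (* Dummy lines turn arbitrary matrices into a configuration, so both evaluations equal the same
     value of g. *)
  pose x k := QPoint (A k) 0%VS.
  by rewrite -(gp (x, w)) -(gp (x, fun k => c k *: w k)).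
apply/seteqP; split=> x /= [Sx nVx]; split=> //.
  move=> w _ _ ->; rewrite -(gp (x, w)) /=; apply/eqP.
  by apply/negPn/negP => gx; apply: nVx.
(* Without an actual family of spanning vectors, membership in the zero locus would be vacuous. *)
case=> _; have [w lw] := lineS x Sx.
by rewrite (gp (x, w)) /= (nVx w lw p) // eqxx.
Qed.

End ZariskiOpen.

(** * Density of the locus where the denominator is nonzero *)

Section Density.
Variables (C : numFieldType) (n : nat) (a : 'I_n.+1 -> C) (s0 s1 : C).
Hypotheses (s0E : s0 ^+ 2 = 2 * a ord0) (s1E : s1 ^+ 2 = 2 * a (inord n.-1)).
Hypothesis hn : (2 <= n)%N.
Local Notation U := (Utilde a s0 s1).
Local Notation penult := (inord n.-1 : 'I_n.+1).

Lemma Utilde_line x : U x -> exists w, forall k, line (x k) = <[w k]>%VS.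
Proof.
by case=> -[Qx _ _] _; exact: fin_all_exists (fun k => in_quadric_line (Qx k)).
Qed.

(* A common eigenvector would make A^(0), A^(n) upper triangular, and then their
   Gram determinant vanishes. *)
Lemma gram_triangularizable (x : conf C n) :
  (forall k, mat (x k) \in sl2 C) -> triangularizable x -> gram x = 0.
Proof.
move=> sx [g detg trig].
have ug : g \in unitmx by rewrite unitmxE detg unitr1.
have conj_tform j k : a_fun j k x =
    tform (g *m mat (x j) *m invmx g) (g *m mat (x k) *m invmx g).
  by rewrite /tform !mulmxA mulmxKV // mxtrace_mulC !mulmxA mulVmx // mul1mx.
have upper k : exists b q, g *m mat (x k) *m invmx g = sl2_mx b q 0.
  have /sl2_mxP[b [q [r eqA]]] : g *m mat (x k) *m invmx g \in sl2 C.
    by rewrite mem_sl2 mxtrace_mulC mulmxA mulVmx // mul1mx -mem_sl2.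
  exists b, q; rewrite eqA; congr sl2_mx.
  have /is_trig_mxP /(_ 0 1 isT) := trig k.
  by rewrite eqA !mxE.
have [b [q eq0]] := upper ord0; have [b' [q' eqn]] := upper ord_max.
by rewrite /gram !conj_tform eq0 eqn !tform_sl2_mx; ring.
Qed.

(** * Moving one inner matrix with the accompanying basis fixed *)

Section Deformation.
Variables (x : conf C n) (sm sp : 'M[C]_2) (i : 'I_n.+1).
Local Notation s3 := (bracket sp sm).
Hypotheses (Ux : U x) (acc : accompanying a s0 s1 x (sm, sp, s3)).
Hypothesis hi : (1 <= i <= n - 2)%N.

Let Qx k : in_quadric (a k) (x k). Proof. by case: Ux => -[]. Qed.
Let sA k : mat (x k) \in sl2 C. Proof. by case: (in_quadric_mat (Qx k)). Qed.
Let sl_m : sm \in sl2 C. Proof. by case: acc => /standard_basis_null_pair[[]]. Qed.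
Let sl_p : sp \in sl2 C. Proof. by case: acc => /standard_basis_null_pair[[]]. Qed.
Let m0 : tform sm sm = 0. Proof. by case: acc => /standard_basis_null_pair[]. Qed.
Let p0 : tform sp sp = 0. Proof. by case: acc => /standard_basis_null_pair[]. Qed.
Let pm : tform sp sm = 1. Proof. by case: acc => /standard_basis_null_pair[]. Qed.
Let sl_3 : s3 \in sl2 C. Proof. exact: bracket_sl2. Qed.
Let eigm := sigma_line_eigen (etrans (sqrrN s0) s0E) (Qx ord0)
  (let: And4 _ Lm _ _ := acc in Lm).
Let eigp := sigma_line_eigen s1E (Qx penult) (let: And4 _ _ Lp _ := acc in Lp).
Let qn : tform (mat (x ord_max)) sm = 1. Proof. by rewrite tformC; case: acc. Qed.

Let b0 : tform (mat (x ord0)) s3 = s0.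
Proof.
have [_ _ _ eig] := eigm; rewrite tformC tform_cycle bracketN eig.
by rewrite scaleNr opprK tformZl tformC pm mulr1.
Qed.

Let b1 : tform (mat (x penult)) s3 = s1.
Proof.
have [_ _ _ eig] := eigp; rewrite tformC 2!tform_cycle eig.
by rewrite tformZl pm mulr1.
Qed.

Let pairings := (tformDl, tformZl, m0, p0, pm, tformC sm sp, tform_s3_s3 sl_m sl_p m0 p0 pm,
  tformC sm s3, tformC sp s3, tform_bracketl, tform_bracketr).

Implicit Types A v : 'M[C]_2.

Definition dbeta A := 2^-1 * tform (A - mat (x i)) s3.
Definition dq A := tform (A - mat (x i)) sm.
Definition dq' A := tform (A - mat (x i)) sp.
Definition beta_max := 2^-1 * tform (mat (x ord_max)) s3.
(** The change of the q' entry of A^(n) that keeps beta^2 + q' = a_nn / 2 when its beta entry drops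
    by [dbeta A]. *)
Definition dq'_max A := beta_max ^+ 2 - (beta_max - dbeta A) ^+ 2.

Definition mat_max A := mat (x ord_max) + (- dbeta A *: s3 + dq'_max A *: sm).
Definition mat_penult A := mat (x penult) + - dq A *: sp.
Definition mat_0 A := mat (x ord0) + - (dq' A + dq'_max A) *: sm.

(* A^(i) is replaced by A; the other three changes keep A^(0), A^(n-1), A^(n) in
   their quadrics, the accompanying basis fixed and the sum zero. *)
Definition deform A v : conf C n := fun k =>
  if k == i then QPoint A <[v]>%VS
  else if k == ord0 then QPoint (mat_0 A) (line (x ord0))
  else if k == penult then QPoint (mat_penult A) (line (x penult))
  else if k == ord_max then
    QPoint (mat_max A) (if a ord_max == 0 then <[mat_max A]>%VS else 0%VS)
  else x k.

Let i_ord0 : (ord0 == i) = false.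
Proof. by apply/eqP => /(congr1 val) /= ; lia. Qed.
Let i_penult : (penult == i) = false.
Proof. by apply/eqP => /(congr1 val) /=; rewrite val_penult; lia. Qed.
Let i_max : (ord_max == i) = false.
Proof. by apply/eqP => /(congr1 val) /=; lia. Qed.

Lemma deform_i A v : deform A v i = QPoint A <[v]>%VS.
Proof. by rewrite /deform eqxx. Qed.

Lemma deform_0 A v : deform A v ord0 = QPoint (mat_0 A) (line (x ord0)).
Proof. by rewrite /deform i_ord0 eqxx. Qed.

Lemma deform_penult A v :
  deform A v penult = QPoint (mat_penult A) (line (x penult)).
Proof.
by rewrite /deform i_penult eq_sym (negPf (ord0_neq_penult hn)) eqxx.
Qed.

Lemma deform_max A v : deform A v ord_max =
  QPoint (mat_max A) (if a ord_max == 0 then <[mat_max A]>%VS else 0%VS).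
Proof.
by rewrite /deform i_max 2!(eq_sym ord_max) (negPf (ord0_neq_max hn))
           (negPf (penult_neq_max hn)) eqxx.
Qed.

Lemma deform_other A v k :
  k != i -> k != ord0 -> k != penult -> k != ord_max -> deform A v k = x k.
Proof. by rewrite /deform => /negPf-> /negPf-> /negPf-> /negPf->. Qed.

Lemma mat_0_coords A : [/\ tform (mat_0 A) s3 = s0, tform (mat_0 A) sm = 0
  & tform (mat_0 A) sp = tform (mat (x ord0)) sp - (dq' A + dq'_max A)].
Proof.
have [_ _ A0m _] := eigm; rewrite /mat_0 !pairings b0 A0m.
by split; ring.
Qed.

Lemma mat_penult_coords A : [/\ tform (mat_penult A) s3 = s1,
  tform (mat_penult A) sm = tform (mat (x penult)) sm - dq A
  & tform (mat_penult A) sp = 0].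
Proof.
have [_ _ A1p _] := eigp; rewrite /mat_penult !pairings b1 A1p.
by split; ring.
Qed.

Lemma mat_max_coords A : [/\ tform (mat_max A) s3 = 2 * (beta_max - dbeta A),
  tform (mat_max A) sm = 1
  & tform (mat_max A) sp = tform (mat (x ord_max)) sp + dq'_max A].
Proof.
rewrite /mat_max !pairings qn /beta_max.
by split; field.
Qed.

Lemma sl2_mat_0 A : mat_0 A \in sl2 C.
Proof. by rewrite memvD ?memvZ. Qed.

Lemma sl2_mat_penult A : mat_penult A \in sl2 C.
Proof. by rewrite memvD ?memvZ. Qed.

Lemma sl2_mat_max A : mat_max A \in sl2 C.
Proof. by rewrite memvD ?memvD ?memvZ. Qed.

Let coordE := tform_coord sl_m sl_p m0 p0 pm.
Let coord3E := tform_bracket_coord sl_m sl_p m0 p0 pm.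

(** The pairing with [sm] stays zero, so only the diagonal entry s0 / 2 contributes. *)
Lemma tform_mat_0 A : tform (mat_0 A) (mat_0 A) = a ord0.
Proof.
rewrite coordE ?sl2_mat_0 //; have [-> -> _] := mat_0_coords A.
transitivity (s0 ^+ 2 / 2); first by field.
by rewrite s0E; field.
Qed.

Lemma tform_mat_penult A : tform (mat_penult A) (mat_penult A) = a penult.
Proof.
rewrite coordE ?sl2_mat_penult //; have [-> _ ->] := mat_penult_coords A.
transitivity (s1 ^+ 2 / 2); first by field.
by rewrite s1E; field.
Qed.

Lemma tform_mat_max A : tform (mat_max A) (mat_max A) = a ord_max.
Proof.
have [_ <-] := in_quadric_mat (Qx ord_max).
rewrite (coordE (sl2_mat_max A) (sl2_mat_max A)) (coordE (sA ord_max) (sA ord_max)).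
have [-> -> ->] := mat_max_coords A.
by rewrite qn /dq'_max /beta_max; field.
Qed.

Lemma deform_sum A v : A \in sl2 C -> \sum_k mat (deform A v k) = 0.
Proof.
(* The deformation is the old configuration plus four increments at distinct indices; expanding A -
   A^(i) in the standard basis shows that they cancel. *)
move=> sA'; pose bump (j : 'I_n.+1) (d : 'M[C]_2) k := if k == j then d else 0.
have sum_bump j d : \sum_(k < n.+1) bump j d k = d.
  by rewrite -big_mkcond big_pred1_eq.
have -> : \sum_k mat (deform A v k) = \sum_k mat (x k)
    + \sum_k bump i (A - mat (x i)) k
    + \sum_k bump ord0 (- (dq' A + dq'_max A) *: sm) k
    + \sum_k bump penult (- dq A *: sp) k
    + \sum_k bump ord_max (- dbeta A *: s3 + dq'_max A *: sm) k.
  rewrite -!big_split; apply: eq_bigr => k _ /=; rewrite /deform /bump.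
  have [->|_] := eqVneq k i.
    by rewrite 3!(eq_sym i) i_ord0 i_penult i_max !addr0 addrC subrK.
  have [->|_] := eqVneq k ord0.
    by rewrite (negPf (ord0_neq_penult hn)) (negPf (ord0_neq_max hn)) !addr0.
  have [->|_] := eqVneq k penult; first by rewrite (negPf (penult_neq_max hn)) !addr0.
  by case: eqP => [->|_]; rewrite !addr0.
rewrite !sum_bump; have [[_ -> _] _] := Ux; rewrite add0r.
have sd : A - mat (x i) \in sl2 C by rewrite memvB.
rewrite {1}(null_pair_decomp sl_m sl_p m0 p0 pm sd) -/(dbeta A) -/(dq A) -/(dq' A).
rewrite !scaleNr scalerDl.
move: (dbeta A *: s3) (dq A *: sp) (dq' A *: sm) (dq'_max A *: sm) => X Y Z T.
by apply/matrixP => r c; rewrite !mxE; ring.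
Qed.

(** A^(0) and A^(n-1) move along [sm] and [sp], which lie on their lines in the nilpotent case;
    A^(n) stays nonzero because it pairs to 1 with [sm], so it can span its own line. *)
Lemma deform_in_quadric A v k :
  in_quadric (a i) (QPoint A <[v]>%VS) -> in_quadric (a k) (deform A v k).
Proof.
move=> QA; have [_ Lm Lp _] := acc.
have [->|ki] := eqVneq k i; first by rewrite deform_i.
have [->|k0] := eqVneq k ord0.
  rewrite deform_0; have := Qx ord0; move: Lm; rewrite /in_quadric /sigma_line /=.
  case: ifP => _ Lm [H l0]; last by rewrite sl2_mat_0 tform_mat_0.
  by split=> //; rewrite memvD ?memvZ.
have [->|k1] := eqVneq k penult.
  rewrite deform_penult; have := Qx penult; move: Lp; rewrite /in_quadric /sigma_line /=.
  case: ifP => _ Lp [H l1]; last by rewrite sl2_mat_penult tform_mat_penult.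
  by split=> //; rewrite memvD ?memvZ.
have [->|k2] := eqVneq k ord_max; last by rewrite deform_other.
rewrite deform_max /in_quadric /=; have sl_max := sl2_mat_max A.
have [a0|_] := eqVneq (a ord_max) 0; last by rewrite sl_max tform_mat_max.
split; last exact: memv_line.
exists (mat_max A); split=> //; last by apply/nilpotent_sl2P; rewrite ?tform_mat_max.
have [_ + _] := mat_max_coords A; apply: contra_eq_neq => ->.
by rewrite /tform mul0mx mxtrace0 eq_sym oner_neq0.
Qed.

Definition q_penult A := tform (mat (x penult)) sm - dq A.

(** Computed directly in the fixed basis, since membership of the deformed configuration in [U] is
    itself deduced from its Gram determinant being nonzero. *)
Lemma deform_denominator A v :
  denominator s0 (deform A v) = 2 * gram (deform A v) ^+ 2 * q_penult A.
Proof.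
rewrite /denominator /q_num /gram /a_fun /f_fun.
rewrite deform_0 deform_max deform_penult /= -!/(tform _ _).
have [s_0 s_1 s_n] := And3 (sl2_mat_0 A) (sl2_mat_penult A) (sl2_mat_max A).
rewrite (coord3E s_0 s_n s_1) (coordE s_0 s_0) (coordE s_n s_n) (coordE s_n s_1).
rewrite (coordE s_0 s_n) (coordE s_0 s_1).
have [-> -> ->] := mat_0_coords A; have [-> -> ->] := mat_penult_coords A.
have [-> -> ->] := mat_max_coords A; rewrite /q_penult.
by field.
Qed.

Lemma deform_gram A v : gram (deform A v) = a ord0 * a ord_max
  - (s0 * (beta_max - dbeta A) + tform (mat (x ord0)) sp - (dq' A + dq'_max A)) ^+ 2.
Proof.
rewrite /gram /a_fun deform_0 deform_max /= -!/(tform _ _).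
rewrite tform_mat_0 tform_mat_max (coordE (sl2_mat_0 A) (sl2_mat_max A)).
have [-> -> ->] := mat_0_coords A; have [-> -> ->] := mat_max_coords A.
by congr (_ - _ ^+ 2); field.
Qed.

(** A nonzero Gram determinant excludes triangularizability, and adding multiples of [sm] to A^(0)
    and of [sp] to A^(n-1) preserves their eigenvector equations. *)
Lemma deform_Utilde A v : in_quadric (a i) (QPoint A <[v]>%VS) ->
  gram (deform A v) != 0 -> U (deform A v).
Proof.
move=> QA gram0; have QD k := deform_in_quadric k QA.
have [sA' _] := in_quadric_mat QA.
have [_ Lm Lp mA] := acc.
split.
  split=> //; first exact: deform_sum.
  move=> /gram_triangularizable; move/eqP: gram0 => gram0; apply: contra_not gram0.
  by apply=> k; case: (in_quadric_mat (QD k)).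
have neq0 (v1 v2 : 'M[C]_2) : tform v1 v2 != 0 -> v1 != 0.
  by apply: contraNneq => ->; rewrite /tform mul0mx mxtrace0.
have [_ max_m _] := mat_max_coords A.
exists sm, sp; split.
- split; first by apply: (neq0 _ sp); rewrite tformC pm oner_neq0.
  move: Lm; rewrite /sigma_line /= deform_0 /=; case: ifP => // _ [_ eig]; split=> //.
  by rewrite bracketDl bracketZl /bracket subrr scaler0 addr0.
- split; first by apply: (neq0 _ sm); rewrite pm oner_neq0.
  move: Lp; rewrite /sigma_line /= deform_penult /=; case: ifP => // _ [_ eig]; split=> //.
  by rewrite bracketDl bracketZl /bracket subrr scaler0 addr0.
- by rewrite tformC pm oner_neq0.
- by rewrite deform_max /= tformC max_m oner_neq0.
Qed.

Variables (w : 'I_n.+1 -> 'M[C]_2) (p : {mpoly C[#|coord_idx n|]}).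
Hypothesis lw : forall k, line (x k) = <[w k]>%VS.
Hypothesis pw : p.@[coords (fun k => mat (x k)) w] != 0.

(** If a_nn = 0, the nonzero matrix A^(n) spans its line, so the spanning vector can follow
    [mat_max] polynomially with a constant factor; otherwise the vector and the factor are zero. *)
Lemma max_vector_scale : exists lam,
  w ord_max = lam *: mat (x ord_max) /\ (lam == 0) = (a ord_max != 0).
Proof.
have := Qx ord_max; case: (x ord_max) (lw ord_max) qn => A l /= ->.
move=> Am /in_quadric_vline; case: eqP => a0.
  case=> _ w0 _ /vlineP[c defA].
  have c0 : c != 0.
    apply: contra_eq_neq Am => c0; rewrite defA c0 scale0r.
    by rewrite /tform mul0mx mxtrace0 eq_sym oner_neq0.
  exists c^-1; rewrite defA scalerA mulVf // scale1r; split=> //.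
  by rewrite invr_eq0 (negPf c0).
by case=> _ _ ->; exists 0; rewrite scale0r eqxx.
Qed.

Section Vectors.
Variable lam : C.
Hypothesis w_max : w ord_max = lam *: mat (x ord_max).
Hypothesis lam0 : (lam == 0) = (a ord_max != 0).

Definition deform_vec A v k :=
  if k == i then v else if k == ord_max then lam *: mat_max A else w k.

Lemma deform_line A v k : line (deform A v k) = <[deform_vec A v k]>%VS.
Proof.
rewrite /deform_vec; have [->|ki] := eqVneq k i; first by rewrite deform_i.
have [->|k2] := eqVneq k ord_max.
  rewrite deform_max /=; case: ifP lam0 => [_ lam_neq0|_ /eqP ->].
    apply/vspaceP => u; apply/vlineP/vlineP => -[c ->].
      exists (c / lam); rewrite scalerA divfK // lam_neq0 //.
    by exists (c * lam); rewrite scalerA.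
  by rewrite scale0r.
have [->|k0] := eqVneq k ord0; first by rewrite deform_0 -lw.
have [->|k1] := eqVneq k penult; first by rewrite deform_penult -lw.
by rewrite deform_other ?lw.
Qed.

Definition deform_eval A v :=
  p.@[coords (fun k => mat (deform A v k)) (deform_vec A v)].

Lemma deform_eval_id : deform_eval (mat (x i)) (w i) != 0.
Proof.
have d0 : [/\ dbeta (mat (x i)) = 0, dq (mat (x i)) = 0 & dq' (mat (x i)) = 0].
  by rewrite /dbeta /dq /dq' subrr /tform !mul0mx mxtrace0 mulr0.
have d1 : dq'_max (mat (x i)) = 0 by rewrite /dq'_max; case: d0 => -> _ _; ring.
have max_id : mat_max (mat (x i)) = mat (x ord_max).
  by rewrite /mat_max d1; case: d0 => -> _ _; rewrite oppr0 !scale0r !addr0.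
suff -> : deform_eval (mat (x i)) (w i) = p.@[coords (fun k => mat (x k)) w] by [].
apply: meval_eq => l; rewrite /coords; case: (enum_val l) => -[[b k] r] c.
case: b.
  rewrite /deform_vec max_id -w_max; have [->//|_] := eqVneq k i.
  by have [->|_] := eqVneq k ord_max.
congr fun_of_matrix; have [->|ki] := eqVneq k i; first by rewrite deform_i.
have [->|k2] := eqVneq k ord_max; first by rewrite deform_max.
have [->|k0] := eqVneq k ord0.
  by rewrite deform_0 /= /mat_0 d1; case: d0 => _ _ ->; rewrite addr0 oppr0 scale0r addr0.
have [->|k1] := eqVneq k penult; last by rewrite deform_other.
by rewrite deform_penult /= /mat_penult; case: d0 => _ -> _; rewrite oppr0 scale0r addr0.
Qed.

(** * Polynomial dependence of the deformation on a curve parameter *)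

Section Curve.
Variables Ac vc : C -> 'M[C]_2.
Local Notation K := (@polynomial_fun C).
Hypotheses (KA : closed_mx K Ac) (Kv : closed_mx K vc).
Let cl := @polynomial_fun_closed C.
Let tform_diff Y : K (fun t => tform (Ac t - mat (x i)) Y).
Proof.
apply: (closed_mx_tr cl); apply: (closed_mxM cl); last exact: (closed_mx_cst cl).
by apply: (closed_mxD cl) => //; apply: (closed_mx_cst cl).
Qed.

Lemma polynomial_dbeta : K (fun t => dbeta (Ac t)).
Proof. by apply: (ring_closedM cl); [exact: (ring_closed_cst cl) | exact: tform_diff]. Qed.

Lemma polynomial_dq'_max : K (fun t => dq'_max (Ac t)).
Proof.
apply: (ring_closedB cl); first exact: (ring_closed_cst cl).
apply: (ring_closedX cl); apply: (ring_closedB cl); first exact: (ring_closed_cst cl).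
exact: polynomial_dbeta.
Qed.

Lemma polynomial_mat_max : closed_mx K (fun t => mat_max (Ac t)).
Proof.
apply: (closed_mxD cl); first exact: (closed_mx_cst cl).
apply: (closed_mxD cl); apply: (closed_mxZ cl); try exact: (closed_mx_cst cl).
  exact: (ring_closedN cl) polynomial_dbeta.
exact: polynomial_dq'_max.
Qed.

Lemma polynomial_q_penult : K (fun t => q_penult (Ac t)).
Proof. by apply: (ring_closedB cl); [exact: (ring_closed_cst cl) | exact: tform_diff]. Qed.

Lemma polynomial_deform_mat k : closed_mx K (fun t => mat (deform (Ac t) (vc t) k)).
Proof.
rewrite /deform; case: (k == i) => //; case: (k == ord0) => /=.
  apply: (closed_mxD cl); first exact: (closed_mx_cst cl).
  apply: (closed_mxZ cl); last exact: (closed_mx_cst cl).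
  apply: (ring_closedN cl); apply: (ring_closedD cl); first exact: tform_diff.
  exact: polynomial_dq'_max.
case: (k == penult) => /=.
  apply: (closed_mxD cl); first exact: (closed_mx_cst cl).
  apply: (closed_mxZ cl); last exact: (closed_mx_cst cl).
  by apply: (ring_closedN cl); exact: tform_diff.
by case: (k == ord_max) => /=; [exact: polynomial_mat_max | exact: (closed_mx_cst cl)].
Qed.

Lemma polynomial_deform_gram : K (fun t => gram (deform (Ac t) (vc t))).
Proof.
have Ka j k : K (fun t => a_fun j k (deform (Ac t) (vc t))).
  by apply: (closed_mx_tr cl); apply: (closed_mxM cl); apply: polynomial_deform_mat.
apply: (ring_closedB cl); first exact: (ring_closedM cl).
exact: (ring_closedX cl).
Qed.

Lemma polynomial_deform_eval : K (fun t => deform_eval (Ac t) (vc t)).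
Proof.
apply: (ring_closed_meval cl) => l; rewrite /coords.
case: (enum_val l) => -[[[] k] r] c; last exact: polynomial_deform_mat.
rewrite /deform_vec; case: (k == i); first exact: Kv.
case: (k == ord_max); last exact: (ring_closed_cst cl).
apply: (closed_mxZ cl); [exact: (ring_closed_cst cl) | exact: polynomial_mat_max].
Qed.

End Curve.

Local Notation admissible A v := (in_quadric (a i) (QPoint A <[v]>%VS)).

Lemma admissible_id : admissible (mat (x i)) (w i).
Proof. by rewrite -lw; have := Qx i; case: (x i). Qed.

Lemma admissible_sl2 A v : admissible A v -> A \in sl2 C.
Proof. by case/in_quadric_mat. Qed.

(** If A^(i) = 0, then a_ii = 0 and A^(i) can leave the vertex along its line in the blow-up, with
    that line unchanged. *)
Lemma nonzero_admissible :
  exists A v, [/\ admissible A v, deform_eval A v != 0 & A != 0].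
Proof.
have Q := admissible_id; have [A0|] := eqVneq (mat (x i)) 0; last first.
  by exists (mat (x i)), (w i); split=> //; apply: deform_eval_id.
have [ai0 [sw w0 tw _]] : a i = 0 /\ [/\ w i \in sl2 C, w i != 0,
    tform (w i) (w i) = 0 & mat (x i) \in <[w i]>%VS].
  have [_] := in_quadric_mat Q; rewrite A0 /= /tform mul0mx mxtrace0 => ai0.
  by move/in_quadric_vline: Q; rewrite -ai0 eqxx A0.
pose Ac (t : C) := t *: w i.
have Kid := polynomial_fun_id C; have cl := @polynomial_fun_closed C.
have cst := @closed_mx_cst _ _ _ cl.
have [||t [ht t0]] := polynomial_fun_nonvanish
  (polynomial_deform_eval (closed_mxZ cl Kid (cst _ _ (w i))) (cst _ _ (w i))) Kid.
- by exists 0; rewrite scale0r -A0; apply: deform_eval_id.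
- by exists 1; rewrite oner_neq0.
exists (t *: w i), (w i); split=> //; last by rewrite scaler_eq0 negb_or t0.
by apply/in_quadric_vline; rewrite ai0 eqxx memvZ ?memv_line.
Qed.

(** Under conjugation by exp(t sigma_-), the pairing with [sp] is quadratic in t, and its
    coefficients are, up to constants, all three coordinates of A; so it is not identically zero. *)
Lemma generic_admissible :
  exists A v, [/\ admissible A v, deform_eval A v != 0 & tform A sp != 0].
Proof.
have [A [v [Q hA A0]]] := nonzero_admissible; have sA' := admissible_sl2 Q.
have Kid := polynomial_fun_id C; have cl := @polynomial_fun_closed C.
have KA X Y := closed_mx_shear X Y cl Kid.
have coord t : tform (shear sm t *m A *m shear sm (- t)) sp
    = tform A sp + tform A s3 * t + (- tform A sm) * t ^+ 2.
  rewrite tform_shear // bracketN -scaleN1r tformZr (tformC sm) pm; ring.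
have [|||t [ht t0]] := polynomial_fun_nonvanish
  (polynomial_deform_eval (KA sm A) (KA sm v))
  (g := fun t => tform (shear sm t *m A *m shear sm (- t)) sp).
- by apply: (closed_mx_tr cl); apply: (closed_mxM cl); last exact: (closed_mx_cst cl).
- by exists 0; rewrite /shear oppr0 scale0r addr0 !mul1mx !mulmx1.
- have [|t ht] := @quadratic_nonvanish C (tform A sp) (tform A s3) (- tform A sm).
    rewrite oppr_eq0 -!negb_and; apply: contraNN A0 => /and3P[/eqP H1 /eqP H2 /eqP H3].
    rewrite (null_pair_decomp sl_m sl_p m0 p0 pm sA') H1 H2 H3.
    by rewrite mulr0 !scale0r !addr0.
  by exists t; rewrite coord.
exists (shear sm t *m A *m shear sm (- t)), (shear sm t *m v *m shear sm (- t)).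
by split=> //; apply: in_quadric_conj (shearK _ _ _) Q.
Qed.

(** Conjugation by exp(t sigma_+) fixes r, the pairing of A with [sp], and r controls the leading
    coefficients of both factors of the denominator. *)
Lemma denominator_admissible : exists A v,
  [/\ admissible A v, deform_eval A v != 0 & denominator s0 (deform A v) != 0].
Proof.
have [A [v [Q hA r0]]] := generic_admissible; have sA' := admissible_sl2 Q.
have Kid := polynomial_fun_id C; have cl := @polynomial_fun_closed C.
have KA X Y := closed_mx_shear X Y cl Kid.
pose Ac t := shear sp t *m A *m shear sp (- t).
pose vc t := shear sp t *m v *m shear sp (- t).
have Ap t : tform (Ac t) sp = tform A sp.
  by rewrite tform_shear // p0 /bracket subrr /tform mulmx0 mxtrace0; ring.
have A3 t : tform (Ac t) s3 = tform A s3 + 2 * t * tform A sp.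
  rewrite tform_shear // (bracketN s3) bracket_s3_sp // -scaleN1r !tformZr.
  by rewrite (tformC sp) tform_bracketl; ring.
have Am t : tform (Ac t) sm = tform A sm - t * tform A s3 - t ^+ 2 * tform A sp.
  by rewrite tform_shear // pm; ring.
have diff X Y : tform (X - mat (x i)) Y = tform X Y - tform (mat (x i)) Y.
  by rewrite /tform mulmxBl raddfB.
have hQ t : admissible (Ac t) (vc t) by apply: in_quadric_conj (shearK _ _ _) Q.
have Keval := polynomial_deform_eval (KA sp A) (KA sp v).
have Kgram := polynomial_deform_gram vc (KA sp A).
have Kq := polynomial_q_penult (KA sp A).
have [||t [gt qt]] := polynomial_fun_nonvanish Kgram Kq.
(* Along the curve the beta entry of A^(n) is b - r t, and a_0n is quadratic in t with leading
   coefficient r^2. *)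
- pose r := tform A sp; pose b := beta_max - 2^-1 * (tform A s3 - tform (mat (x i)) s3).
  pose d := tform (mat (x ord0)) sp - (r - tform (mat (x i)) sp) - beta_max ^+ 2.
  have [t ht] := @quadratic_sqr_nonvanish C (a ord0 * a ord_max)
    (s0 * b + d + b ^+ 2) (- s0 * r - 2 * b * r) (r ^+ 2) (expf_neq0 _ r0).
  exists t; rewrite deform_gram; apply: contraNneq ht => <-; apply/eqP.
  rewrite /dq' /dq'_max /dbeta !diff -!/(Ac t) Ap A3 /b /d /r; congr (_ - _ ^+ 2).
  by field.
(* The q entry of A^(n-1) is quadratic in t with leading coefficient r. *)
- have [|t ht] := @quadratic_nonvanish C
    (tform (mat (x penult)) sm - (tform A sm - tform (mat (x i)) sm))
    (tform A s3) (tform A sp); first by rewrite r0 !orbT.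
  exists t; rewrite /q_penult /dq diff -!/(Ac t) Am; apply: contraNneq ht => <-.
  by apply/eqP; ring.
have Kden : polynomial_fun
    (fun t => gram (deform (Ac t) (vc t)) * q_penult (Ac t)).
  exact: (ring_closedM cl).
(* The evaluated polynomial is nonzero at parameter 0 and the denominator factors at t; some u
   serves for both. *)
have [||u [hu]] := polynomial_fun_nonvanish Keval Kden.
- by exists 0; rewrite /shear oppr0 scale0r addr0 !mul1mx !mulmx1.
- by exists t; rewrite mulf_neq0.
rewrite mulf_eq0 negb_or => /andP[gu qu].
exists (Ac u), (vc u); split=> //.
by rewrite deform_denominator !mulf_neq0 ?expf_neq0 ?pnatr_eq0.
Qed.

End Vectors.

Lemma deformation_exists : exists y w', [/\ U y /\ denominator s0 y != 0,
  forall k, line (y k) = <[w' k]>%VS & p.@[coords (fun k => mat (y k)) w'] != 0].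
Proof.
have [lam [w_max lam0]] := max_vector_scale.
have [A [v [Q hA den]]] := denominator_admissible w_max.
exists (deform A v), (deform_vec lam A v); split=> //; last by move=> k; exact: deform_line.
split=> //; apply: deform_Utilde => //.
by apply: contraNneq den => g0; rewrite deform_denominator g0 expr0n mulr0 mul0r.
Qed.

End Deformation.

(** If a defining polynomial of a closed set containing the locus were nonzero at x, a deformation
    at the inner index i would reach the locus with that polynomial still nonzero. *)
Lemma denominator_dense (i : 'I_n.+1) : (1 <= i <= n - 2)%N ->
  zariski_dense_in U [set x | U x /\ denominator s0 x != 0].
Proof.
move=> hi _ [F _ ->] VZ x Ux; split=> // w lw p Fp; apply/eqP/negPn/negP => pw.
have := accompanying_exists s0E s1E Ux.
case: (acc_basis a s0 s1 x) => -[sm sp] s3 acc.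
have [sb _ _ _] := acc; have [_ _ _ _ def3] := standard_basis_null_pair sb.
rewrite def3 in acc.
have [y [w' [Vy lw' pw']]] := deformation_exists Ux acc hi lw pw.
by have [_ /(_ w' lw' p Fp) py] := VZ y Vy; rewrite py eqxx in pw'.
Qed.

End Density.

(** * Both directions of the birational correspondence *)

Theorem theorem3 (R : realType) (n : nat) (hn : (2 <= n)%N)
    (a : 'I_n.+1 -> R[i]%C) (s0 s1 : R[i]%C)
    (hs0 : s0 ^+ 2 = 2 * a ord0)
    (hs1 : s1 ^+ 2 = 2 * a (inord n.-1)) :
  let U := Utilde a s0 s1 in
  let elements := matrix_elements a s0 s1 in
  ((forall i j : 'I_n.+1, rational_in U elements (a_fun i j)) /\
   (forall i j k : 'I_n.+1, rational_in U elements (f_fun i j k)))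
  /\
  (forall i : 'I_n.+1, (1 <= i <= n - 2)%N ->
     [/\ rational_in U (@invariants _ n) (beta_fun a s0 s1 i),
         rational_in U (@invariants _ n) (q_fun a s0 s1 i)
       & rational_in U (@invariants _ n) (q'_fun a s0 s1 i)]).
Proof.
have denseU : zariski_dense_in (Utilde a s0 s1) (Utilde a s0 s1) by [].
have coordD := coord_polynomial_closed R[i]%C n.
have ca := @coord_polynomial_a_fun R[i]%C n.
have cf := @coord_polynomial_f_fun R[i]%C n.
split.
  have rational_elements g :
      rational_on (Utilde a s0 s1) (matrix_elements a s0 s1) g ->
      rational_in (Utilde a s0 s1) (matrix_elements a s0 s1) g.
    move=> [P [Q PQ]]; exists P, Q, (Utilde a s0 s1); split=> //.
    (* In this direction the expressions hold on the whole space, which is open in itself as the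
       nonvanishing locus of the constant 1. *)
    have := zariski_open_nonvanishing (g := fun=> 1) (@Utilde_line _ _ a s0 s1)
      (ring_closed_cst coordD 1).
    congr zariski_open_in; apply/seteqP; split=> x //=; first by case.
    by rewrite oner_neq0.
  split=> [i j|i j k]; apply: rational_elements.
    exact: rational_a_fun hs0 hs1 hn i j.
  exact: rational_f_fun hs0 hs1 hn i j k.
move=> i hi.
pose V := [set x | Utilde a s0 s1 x /\ denominator s0 x != 0]%classic.
have openV : zariski_open_in (Utilde a s0 s1) V.
  apply: zariski_open_nonvanishing; first exact: Utilde_line.
  rewrite /denominator /gram /q_num.
  by do !first [ exact: ca | exact: cf | exact: (ring_closed_cst coordD)
    | apply: (ring_closedB coordD) | apply: (ring_closedM coordD)
    | apply: (ring_closedX coordD) ].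
have denseV : zariski_dense_in (Utilde a s0 s1) V.
  (* The index i whose matrix elements are sought also serves as the inner index to be deformed. *)
  exact (denominator_dense hs0 hs1 hn hi).
have rational_invariants g : rational_on V (@invariants R[i]%C n) g ->
    rational_in (Utilde a s0 s1) (@invariants R[i]%C n) g.
  by move=> [P [Q PQ]]; exists P, Q, V; split.
split; apply: rational_invariants.
- exact: rational_inv_beta.
- exact: rational_inv_q.
- exact: rational_inv_q'.
Qed.
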